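(* There exists a surjective homomorphism of superalgebras $\varphi:Y(Q(1))\to W_\chi$ defined by $$\varphi(T_{1,1}^{(k)})=(-1)^k\pi(e_{n,1}^{(n+k-1)}),\qquad \varphi(T_{-1,1}^{(k)})=(-1)^k\pi(f_{n,1}^{(n+k-1)}),\qquad k=1,2,\dots$$
   Context: $Y(Q(1))$ is the Nazarov–Sergeev super-Yangian: the unital associative superalgebra with generators $T_{i,j}^{(m)}$, $m\ge1$, $i,j\in\{\pm1\}$, of parity $p(i)+p(j)$ ($p(1)=0$, $p(-1)=1$), with $T_{i,j}^{(0)}=\delta_{ij}$, subject to $T_{-i,-j}^{(m)}=(-1)^mT_{i,j}^{(m)}$ and $([T_{i,j}^{(m+1)},T_{k,l}^{(r-1)}]-[T_{i,j}^{(m-1)},T_{k,l}^{(r+1)}])(-1)^{p(i)p(k)+p(i)p(l)+p(k)p(l)}=T_{k,j}^{(m)}T_{i,l}^{(r-1)}+T_{k,j}^{(m-1)}T_{i,l}^{(r)}-T_{k,j}^{(r-1)}T_{i,l}^{(m)}-T_{k,j}^{(r)}T_{i,l}^{(m-1)}+(-1)^{p(k)+p(l)}(-T_{-k,j}^{(m)}T_{-i,l}^{(r-1)}+T_{-k,j}^{(m-1)}T_{-i,l}^{(r)}+T_{k,-j}^{(r-1)}T_{i,-l}^{(m)}-T_{k,-j}^{(r)}T_{i,-l}^{(m-1)})$. On the other side, $\mathfrak g=Q(n)$ with even basis $e_{i,j}$ and odd basis $f_{i,j}$; $\chi(x)=\mathrm{otr}(xE)$ with $E=\sum_{i=1}^{n-1}f_{i,i+1}$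 regular nilpotent; $\mathfrak m$ is spanned by $e_{i,j},f_{i,j}$ with $i>j$, $\chi(e_{i+1,i})=1$ and $\chi$ vanishes on the other basis vectors of $\mathfrak m$; $I_\chi$ is the left ideal generated by $a-\chi(a)$, $a\in\mathfrak m$; $\pi:U(\mathfrak g)\to U(\mathfrak g)/I_\chi$; $W_\chi=\{\pi(y):\mathrm{ad}(a)y\in I_\chi\ \forall a\in\mathfrak m\}$. Sergeev's elements of $U(Q(n))$ are $e_{i,j}^{(1)}=e_{i,j}$, $f_{i,j}^{(1)}=f_{i,j}$, and $e_{i,j}^{(m)}=\sum_k e_{i,k}e_{k,j}^{(m-1)}+(-1)^{m+1}\sum_k f_{i,k}f_{k,j}^{(m-1)}$, $f_{i,j}^{(m)}=\sum_k e_{i,k}f_{k,j}^{(m-1)}+(-1)^{m+1}\sum_k f_{i,k}e_{k,j}^{(m-1)}$. *)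

(* Defs.v *)
(* Presented (super)algebras are encoded by formal terms
   modulo the congruence generated by the unital associative K-algebra axioms
   and the defining relations. *)
From HB Require Import structures.
From mathcomp Require Import all_boot all_order all_algebra.
Set Implicit Arguments. Unset Strict Implicit. Unset Printing Implicit Defensive.
Import GRing.Theory.
Local Open Scope ring_scope.

Section Presented.
Variable K : fieldType.
Variable X : Type.

Inductive term : Type :=
  | Tg of X
  | Tc of K
  | Tadd of term & term
  | Tmul of term & term.

Definition tscale (c : K) (t : term) := Tmul (Tc c) t.
Definition tneg (t : term) := tscale (-1) t.
Definition tsub (t u : term) := Tadd t (tneg u).
Definition tsum (s : seq term) := foldr Tadd (Tc 0) s.

(* equality in the presented algebra  K<X> / (a - b : R a b) *)
Inductive ceq (R : term -> term -> Prop) : term -> term -> Prop :=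
  | ce_rel a b : R a b -> ceq R a b
  | ce_refl a : ceq R a a
  | ce_sym a b : ceq R a b -> ceq R b a
  | ce_trans a b c : ceq R a b -> ceq R b c -> ceq R a c
  | ce_add a a' b b' : ceq R a a' -> ceq R b b' -> ceq R (Tadd a b) (Tadd a' b')
  | ce_mul a a' b b' : ceq R a a' -> ceq R b b' -> ceq R (Tmul a b) (Tmul a' b')
  | ce_addA a b c : ceq R (Tadd (Tadd a b) c) (Tadd a (Tadd b c))
  | ce_addC a b : ceq R (Tadd a b) (Tadd b a)
  | ce_add0 a : ceq R (Tadd a (Tc 0)) a
  | ce_addN a : ceq R (Tadd a (tneg a)) (Tc 0)
  | ce_mulA a b c : ceq R (Tmul (Tmul a b) c) (Tmul a (Tmul b c))
  | ce_mul1l a : ceq R (Tmul (Tc 1) a) a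
  | ce_mul1r a : ceq R (Tmul a (Tc 1)) a
  | ce_mulDl a b c : ceq R (Tmul (Tadd a b) c) (Tadd (Tmul a c) (Tmul b c))
  | ce_mulDr a b c : ceq R (Tmul a (Tadd b c)) (Tadd (Tmul a b) (Tmul a c))
  | ce_cadd x y : ceq R (Tadd (Tc x) (Tc y)) (Tc (x + y))
  | ce_cmul x y : ceq R (Tmul (Tc x) (Tc y)) (Tc (x * y))
  | ce_ccomm x a : ceq R (Tmul (Tc x) a) (Tmul a (Tc x)).

Variable par : X -> bool.   (* parity of generators: false = even *)

Inductive homog : bool -> term -> Prop :=
  | hom_gen x : homog (par x) (Tg x)
  | hom_c c : homog false (Tc c)
  | hom_0 p : homog p (Tc 0)
  | hom_add p a b : homog p a -> homog p b -> homog p (Tadd a b)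
  | hom_mul p q a b : homog p a -> homog q b -> homog (p (+) q) (Tmul a b).

(* the parity automorphism  y |-> (-1)^{p(y)} y  *)
Fixpoint tsigma (t : term) : term :=
  match t with
  | Tg x => if par x then tneg (Tg x) else Tg x
  | Tc c => Tc c
  | Tadd a b => Tadd (tsigma a) (tsigma b)
  | Tmul a b => Tmul (tsigma a) (tsigma b)
  end.

Definition tscomm (pa pb : bool) (a b : term) :=
  tsub (Tmul a b) (tscale ((-1) ^+ (pa && pb)) (Tmul b a)).

End Presented.

Arguments Tc {K X}.
Arguments Tg {K X}.

Inductive pm := P1 | M1.

Definition pp (i : pm) : bool := if i is M1 then true else false.
Definition negpm (i : pm) : pm := if i is P1 then M1 else P1.
Definition dpm {K : fieldType} (i j : pm) : K :=
  match i, j with P1, P1 => 1 | M1, M1 => 1 | _, _ => 0 end.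

(* YT i j m  is the generator T_{i,j}^{(m+1)} *)
Inductive YG := YT of pm & pm & nat.

Definition Ypar (g : YG) : bool := let: YT i j _ := g in pp i (+) pp j.

Section Yangian.
Variable K : fieldType.
Local Notation yterm := (term K YG).

Definition Tt (i j : pm) (m : nat) : yterm :=
  match m with 0 => Tc (dpm i j) | m'.+1 => Tg (YT i j m') end.

Definition sgnK (b : nat) : K := (-1) ^+ b.

Inductive RY : yterm -> yterm -> Prop :=
  | ry_sym i j m : (1 <= m)%N ->
      RY (Tt (negpm i) (negpm j) m) (tscale (sgnK m) (Tt i j m))
  | ry_main i j k l m r : (1 <= m)%N -> (1 <= r)%N ->
      let pij := pp i (+) pp j in
      let pkl := pp k (+) pp l in
      RY (tscale (sgnK ((pp i && pp k) + (pp i && pp l) + (pp k && pp l)))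
            (tsub (tscomm pij pkl (Tt i j m.+1) (Tt k l r.-1))
                  (tscomm pij pkl (Tt i j m.-1) (Tt k l r.+1))))
         (Tadd
           (tsub (tsub (Tadd (Tmul (Tt k j m) (Tt i l r.-1))
                             (Tmul (Tt k j m.-1) (Tt i l r)))
                       (Tmul (Tt k j r.-1) (Tt i l m)))
                 (Tmul (Tt k j r) (Tt i l m.-1)))
           (tscale (sgnK (pp k + pp l))
             (Tadd
               (tsub (Tadd (tneg (Tmul (Tt (negpm k) j m) (Tt (negpm i) l r.-1)))
                           (Tmul (Tt (negpm k) j m.-1) (Tt (negpm i) l r)))
                     (tneg (Tmul (Tt k (negpm j) r.-1) (Tt i (negpm l) m))))
               (tneg (Tmul (Tt k (negpm j) r) (Tt i (negpm l) m.-1)))))).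

Definition yeq := ceq RY.

End Yangian.

Section Qn.
Variable K : fieldType.
Variable n : nat.

(* basis of Q(n): (false,i,j) = e_{i+1,j+1}, (true,i,j) = f_{i+1,j+1} *)
Definition QB := (bool * 'I_n * 'I_n)%type.
Definition Qpar (b : QB) : bool := b.1.1.

Local Notation uterm := (term K QB).

Definition qgen (isf : bool) (i j : 'I_n) : uterm := Tg (isf, i, j).

(* bracket in Q(n) (realized in gl(n|n) by e_{ij} = E_{ij}+E_{-i,-j},
   f_{ij} = E_{i,-j}+E_{-i,j}):
   [e_ij,e_kl] = d_jk e_il - d_li e_kj,  [e_ij,f_kl] = d_jk f_il - d_li f_kj,
   [f_ij,e_kl] = d_jk f_il - d_li f_kj,  [f_ij,f_kl] = d_jk e_il + d_li e_kj *)
Definition qbracket (b b' : QB) : uterm :=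
  let: (x, i, j) := b in let: (y, k, l) := b' in
  Tadd (tscale (j == k)%:R (qgen (x (+) y) i l))
       (tscale ((if x && y then 1 else -1) * (l == i)%:R) (qgen (x (+) y) k j)).

Inductive RU : uterm -> uterm -> Prop :=
  | ru_br b b' : RU (tscomm (Qpar b) (Qpar b') (Tg b) (Tg b')) (qbracket b b').

Definition ueq := ceq RU.

(* m = span of e_{ij}, f_{ij} with i > j; an element is a coefficient vector *)
Definition lowerQ (b : QB) : bool := (val b.2 < val b.1.2)%N.
Definition in_m (c : {ffun QB -> K}) : Prop := forall b, ~~ lowerQ b -> c b = 0.
Definition memb (c : {ffun QB -> K}) : uterm :=
  tsum [seq tscale (c b) (Tg b) | b <- (enum [set: bool * 'I_n * 'I_n])].

Definition chi0 (b : QB) : K :=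
  if (~~ b.1.1) && (val b.1.2 == (val b.2).+1) then 1 else 0.
Definition chi (c : {ffun QB -> K}) : K := \sum_(b : QB) c b * chi0 b.

Inductive inI : uterm -> Prop :=
  | I_0 : inI (Tc 0)
  | I_add a b : inI a -> inI b -> inI (Tadd a b)
  | I_gen u c : in_m c -> inI (Tmul u (tsub (memb c) (Tc (chi c))))
  | I_eq a b : inI a -> ueq a b -> inI b.

(* pi y = pi y'  in U(Q(n)) / I_chi *)
Definition pieq (y y' : uterm) : Prop := inI (tsub y y').

(* super adjoint action ad(a) y, extended linearly from basis vectors:
   ad(b) y = b y - (-1)^{p(b)p(y)} y b *)
Definition ad (c : {ffun QB -> K}) (y : uterm) : uterm :=
  tsum [seq tscale (c b)
              (tsub (Tmul (Tg b) y)
                    (Tmul (if Qpar b then tsigma Qpar y else y) (Tg b)))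
       | b <- (enum [set: bool * 'I_n * 'I_n])].

Definition inW (y : uterm) : Prop :=
  exists y', pieq y y' /\ forall c, in_m c -> inI (ad c y').

(* Sergeev's elements: serg m false i j = e_{ij}^{(m)}, serg m true i j = f_{ij}^{(m)}
   (m >= 1; serg 0 is an unused dummy) *)
Fixpoint serg (m : nat) (isf : bool) (i j : 'I_n) : uterm :=
  match m with
  | 0 => Tc 0
  | m'.+1 =>
      if m' == 0%N then qgen isf i j else
      Tadd (tsum [seq Tmul (qgen false i k) (serg m' isf k j) | k <- enum 'I_n])
           (tscale ((-1) ^+ m.+1)
              (tsum [seq Tmul (qgen true i k) (serg m' (~~ isf) k j) | k <- enum 'I_n]))
  end.

(* phi (on terms) induces a homomorphism of superalgebras Y(Q(1)) -> W_chi,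
   where W_chi carries the product pi(y1) pi(y2) = pi(y1 y2) *)
Definition W_superhom (phi : term K YG -> uterm) : Prop :=
  (forall t, inW (phi t)) /\
  (forall t t', yeq t t' -> pieq (phi t) (phi t')) /\
  [/\ (forall t u, pieq (phi (Tadd t u)) (Tadd (phi t) (phi u))),
      (forall t u, pieq (phi (Tmul t u)) (Tmul (phi t) (phi u))),
      (forall c, pieq (phi (Tc c)) (Tc c)) &
      (forall g, exists h, homog Qpar (Ypar g) h /\ pieq (phi (Tg g)) h)].

Definition W_surjective (phi : term K YG -> uterm) : Prop :=
  forall y, inW y -> exists t, pieq (phi t) y.

End Qn.

Definition ord_first (n : nat) (hn : (0 < n)%N) : 'I_n := Ordinal hn.
Definition ord_last (n : nat) (hn : (0 < n)%N) : 'I_n :=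
  Ordinal (n := n) (m := n.-1) (eq_ind_r is_true hn (ltn_predL n)).

(* Main.v *)
(* The elements e_{ij}^{(m)} and f_{ij}^{(m)} are, up to sign,
   entries of the m-th power of one 2n x 2n matrix over U(Q(n)), and these entries
   satisfy the Yangian relations for all signed indices.  The entries in row n and
   column 1 supercommute with the lower triangular subalgebra, so they act on
   U / I_chi from the right.  Modulo I_chi those with exponents 0, ..., n - 1 are
   0, ..., 0, 1 (even case) and 0 (odd case), so that after shifting the exponent by
   n - 1 they satisfy the relations of Y(Q(1)), including T^{(0)} = delta.

   Surjectivity follows Skryabin.  Filter U / I_chi so that the graded object is
   supercommutative and the Whittaker operators act on it as constant-coefficient
   derivations.  A basis of the upper triangular part splits into coordinates y dual
   to these derivations and the centralizer of E, whose elements are the leading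
   terms of the images of the Yangian generators.  Hence every vector is a sum of
   ordered monomials in the y's times elements of the image, and applying dual
   derivations to a Whittaker vector kills all coefficients but the constant one. *)

(* The degree 2(j - i) + 1 of a letter x_ij does three things at once. It is positive on upper and
   negative on lower triangular letters. A bracket loses one degree, so brackets disappear from the
   graded algebra. Two letters whose bracket has a nonzero value under chi have opposite degrees, so
   this value does not disappear: it is the constant of a derivation. Since I_chi contains
   everything of negative degree, an identity known only up to smaller degree becomes an exact
   congruence modulo I_chi once enough operators of negative degree have been applied to it.
   Characteristic zero is needed for two divisions: the square of an odd element is half its bracket
   with itself, and a derivation applied to a power produces the exponent as a factor. The quotient
   U / I_chi is only a left module. Congruences may be multiplied only when the right factor maps
   I_chi into itself, and for the images of the Yangian generators this has to be proved before any
   relation is checked. *)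
Require Import Defs.
From HB Require Import structures.
From mathcomp Require Import all_boot all_order all_algebra.
From mathcomp Require Import generic_quotient boolp zify.
Set Implicit Arguments. Unset Strict Implicit. Unset Printing Implicit Defensive.
Import Order.TTheory GRing.Theory Num.Theory.
Local Open Scope ring_scope.

(** * Noncommutative ring identities *)

(* A reflexive decision procedure for identities between noncommutative
   polynomials whose coefficients are signs and natural numbers: both sides are
   expanded into signed words, which are then cancelled in pairs. *)
Inductive ncexp :=
  | NC0 | NC1 | NCvar of nat | NCadd of ncexp & ncexp | NCopp of ncexp
  | NCmul of ncexp & ncexp | NCmuln of ncexp & nat.

(** A sign, the natural number multipliers, and the word. The multipliers are central, hence kept as
    a sorted list; the order of the word matters. *)
Definition ncmono := (bool * (seq nat * seq nat))%type.

Definition ncopp (m : ncmono) : ncmono := (~~ m.1, m.2).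

Definition ncmul (m m' : ncmono) : ncmono :=
  (m.1 (+) m'.1, (sort leq (m.2.1 ++ m'.2.1), m.2.2 ++ m'.2.2)).

Fixpoint ncnorm (e : ncexp) : seq ncmono :=
  match e with
  | NC0 => [::]
  | NC1 => [:: (false, ([::], [::]))]
  | NCvar i => [:: (false, ([::], [:: i]))]
  | NCadd a b => ncnorm a ++ ncnorm b
  | NCopp a => map ncopp (ncnorm a)
  | NCmul a b => [seq ncmul m m' | m <- ncnorm a, m' <- ncnorm b]
  | NCmuln a i => [seq ncmul (false, ([:: i], [::])) m | m <- ncnorm a]
  end.

Definition nccancel (m : ncmono) (s : seq ncmono) :=
  if ncopp m \in s then rem (ncopp m) s else m :: s.

Definition nceqb (a b : ncexp) : bool :=
  foldr nccancel [::] (ncnorm (NCadd a (NCopp b))) == [::].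

Section NcEval.
Variables (V : nzRingType) (s : seq V) (t : seq nat).

Fixpoint nceval (e : ncexp) : V :=
  match e with
  | NC0 => 0
  | NC1 => 1
  | NCvar i => s`_i
  | NCadd a b => nceval a + nceval b
  | NCopp a => - nceval a
  | NCmul a b => nceval a * nceval b
  | NCmuln a i => nceval a *+ nth 0%N t i
  end.

Definition ncmonoval (m : ncmono) : V :=
  (-1) ^+ m.1 *
  ((\prod_(i <- m.2.2) s`_i) *+ (\prod_(i <- m.2.1) nth 0 t i)%N).

Lemma ncmonoval_opp m : ncmonoval (ncopp m) = - ncmonoval m.
Proof. by rewrite /ncmonoval signrN mulNr. Qed.

Lemma ncmonoval_mul m m' : ncmonoval (ncmul m m') = ncmonoval m * ncmonoval m'.
Proof.
rewrite /ncmonoval /= (perm_big (m.2.1 ++ m'.2.1)) ?perm_sort //= !big_cat /=.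
rewrite signr_addb mulrnA.
case: m.1 m'.1 => -[]; rewrite !(mul1r, mulN1r, mulNr, mulrN, mulr1, opprK) //=.
all: by rewrite mulrnAr mulrnAl.
Qed.

Lemma nceval_norm e : nceval e = \sum_(m <- ncnorm e) ncmonoval m.
Proof.
elim: e => [|||a IHa b IHb|a IHa|a IHa b IHb|a IHa i] /=.
- by rewrite big_nil.
- by rewrite big_seq1 /ncmonoval /= !big_nil mulr1n mulr1.
- by move=> i; rewrite big_seq1 /ncmonoval /= !big_nil big_seq1 mulr1n mul1r.
- by rewrite big_cat IHa IHb.
- by rewrite big_map IHa -sumrN; apply: eq_bigr => m _; rewrite ncmonoval_opp.
- rewrite IHa IHb mulr_suml big_allpairs_dep /=; apply: eq_bigr => m _.
  by rewrite mulr_sumr; apply: eq_bigr => m' _; rewrite ncmonoval_mul.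
- rewrite big_map IHa -sumrMnl; apply: eq_bigr => m _.
  by rewrite ncmonoval_mul /ncmonoval /= !big_nil big_seq1 mul1r mulrnAl mul1r.
Qed.

Lemma nccancel_sum (l : seq ncmono) :
  \sum_(m <- foldr nccancel [::] l) ncmonoval m = \sum_(m <- l) ncmonoval m.
Proof.
elim: l => [|m l IHl] //=; rewrite big_cons -{}IHl /nccancel.
case: ifP => [ml|_]; last by rewrite big_cons.
by rewrite [in RHS](perm_big _ (perm_to_rem ml)) big_cons ncmonoval_opp addNKr.
Qed.

Lemma ncevalP a b : nceqb a b -> nceval a = nceval b.
Proof.
move=> /eqP ab0; apply/eqP; rewrite -subr_eq0.
by rewrite -[_ - _]/(nceval (NCadd a (NCopp b))) nceval_norm -nccancel_sum ab0 big_nil.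
Qed.

End NcEval.

(* In an empty discriminated database all constants are opaque, so atoms are compared without being
   unfolded. *)
Create HintDb ncdb discriminated.

Ltac ncfind t s :=
  match s with
  | ?u :: _ => let _ := match goal with _ => unify t u with ncdb end in constr:(0%N)
  | _ :: ?s' => let i := ncfind t s' in constr:(S i)
  end.

Ltac ncins t s :=
  match s with
  | _ => let _ := ncfind t s in s
  | _ => constr:(t :: s)
  end.

Ltac ncatoms t e :=
  lazymatch e with (?s, ?c) =>
  lazymatch t with
  | GRing.add ?a ?b => let e' := ncatoms a e in ncatoms b e'
  | GRing.mul ?a ?b => let e' := ncatoms a e in ncatoms b e'
  | GRing.opp ?a => ncatoms a e
  | GRing.zero => e
  | @GRing.one _ => e
  | GRing.exp (GRing.opp (@GRing.one _)) ?b => e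
  | GRing.natmul ?a 0%N => e
  | GRing.natmul ?a 1%N => ncatoms a e
  | GRing.natmul ?a ?n =>
      let c' := ncins n c in ncatoms a (s, c')
  | _ => let s' := ncins t s in constr:((s', c))
  end end.

Ltac ncreify t s c :=
  lazymatch t with
  | GRing.add ?a ?b =>
      let a' := ncreify a s c in let b' := ncreify b s c in constr:(NCadd a' b')
  | GRing.mul ?a ?b =>
      let a' := ncreify a s c in let b' := ncreify b s c in constr:(NCmul a' b')
  | GRing.opp ?a => let a' := ncreify a s c in constr:(NCopp a')
  | GRing.zero => constr:(NC0)
  | @GRing.one _ => constr:(NC1)
  | GRing.exp (GRing.opp (@GRing.one _)) ?b =>
      lazymatch eval cbv in b with
      | 1%N => constr:(NCopp NC1)
      | 0%N => constr:(NC1)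
      end
  | GRing.natmul ?a 0%N => constr:(NC0)
  | GRing.natmul ?a 1%N => ncreify a s c
  | GRing.natmul ?a ?n =>
      let a' := ncreify a s c in let i := ncfind n c in constr:(NCmuln a' i)
  | _ => let i := ncfind t s in constr:(NCvar i)
  end.

Ltac ncring :=
  lazymatch goal with |- @eq ?T ?a ?b =>
    let e := ncatoms a (@nil T, @nil nat) in let e := ncatoms b e in
    lazymatch e with (?s, ?c) =>
    let a' := ncreify a s c in let b' := ncreify b s c in
    apply: (@ncevalP _ s c a' b'); vm_compute; reflexivity
    end
  end.

(** * Sergeev's elements and the Yangian relations *)

Section Sergeev.
Variables (U : nzRingType) (n : nat) (x : bool -> 'I_n -> 'I_n -> U).

(** The parities are arguments because [U] carries no grading. *)
Definition scom (p q : bool) (u v : U) : U := u * v - (-1) ^+ (p && q) * (v * u).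

Hypothesis x_br : forall e d i j k l, scom e d (x e i j) (x d k l) =
  x (e (+) d) i l *+ (j == k) - (-1) ^+ (e && d) * x (e (+) d) k j *+ (l == i).

Local Notation idx := (bool * 'I_n)%type.

Definition negi (a : idx) : idx := (~~ a.1, a.2).

(* The matrix [[E, F], [-F, -E]], where E = (e_ij) and F = (f_ij), with rows and
   columns indexed by signed indices ((true, i) standing for -i).  The alternating
   signs in Sergeev's recursion are produced by its powers. *)
Definition gmx (a b : idx) : U := (-1) ^+ a.1 * x (a.1 (+) b.1) a.2 b.2.

(* (-1)^m times the entry (j, i) of the m-th power of [gmx]: the transposition and
   the sign are those of T_{i,j}^{(m)} |-> (-1)^m e_{j,i}^{(m)}. *)
Fixpoint gpow (m : nat) (i j : idx) : U :=
  if m is m'.+1 then - \sum_a gmx j a * gpow m' i a else (i == j)%:R.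

Lemma negiK : involutive negi.
Proof. by case=> -[] i. Qed.

Lemma gpowS m i j : gpow m.+1 i j = - \sum_a gmx j a * gpow m i a.
Proof. by []. Qed.

Lemma signC (b : bool) (u v : U) : u * ((-1) ^+ b * v) = (-1) ^+ b * (u * v).
Proof. by case: b; rewrite ?expr0 ?expr1 ?mul1r // !mulN1r mulrN. Qed.

Lemma gmx_neg a b : gmx (negi a) (negi b) = - gmx a b.
Proof. by rewrite /gmx /= addbN addNb negbK signrN mulNr. Qed.

Lemma sum_negi (F : idx -> U) : \sum_a F (negi a) = \sum_a F a.
Proof. by rewrite [RHS](reindex_inj (can_inj negiK)). Qed.

Lemma gpow_neg m i j : gpow m (negi i) (negi j) = (-1) ^+ m * gpow m i j.
Proof.
elim: m j => [|m IHm] j; first by rewrite expr0 mul1r /= (can_eq negiK).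
rewrite !gpowS -sum_negi exprS mulN1r mulNr mulrN opprK -!sumrN mulr_sumr.
apply: eq_bigr => a _; rewrite gmx_neg IHm mulNr opprK.
by rewrite -signr_odd signC.
Qed.

Lemma gpow_mul p q i l : \sum_a gpow p a l * gpow q i a = gpow (p + q) i l.
Proof.
elim: p l => [|p IHp] l.
  rewrite (bigD1 l) //= eqxx mul1r big1 ?addr0 // => a /negPf.
  by move=> ->; rewrite mul0r.
rewrite addSn gpowS; under eq_bigr do rewrite gpowS mulNr mulr_suml.
rewrite sumrN exchange_big /=; congr (- _); apply: eq_bigr => b _.
by rewrite -IHp mulr_sumr; apply: eq_bigr => a _; rewrite mulrA.
Qed.

Lemma scomMl (p p' q : bool) u v w :
  scom (p (+) p') q (u * v) w =
  u * scom p' q v w + (-1) ^+ (p' && q) * (scom p q u w * v).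
Proof. by rewrite /scom; case: p p' q => -[] []; ncring. Qed.

Lemma scomMr (p q q' : bool) u v w :
  scom p (q (+) q') u (v * w) =
  scom p q u v * w + (-1) ^+ (p && q) * (v * scom p q' u w).
Proof. by rewrite /scom; case: p q q' => -[] []; ncring. Qed.

Lemma scomNl p q u v : scom p q (- u) v = - scom p q u v.
Proof. by rewrite /scom; case: (p && q); ncring. Qed.

Lemma scomNr p q u v : scom p q u (- v) = - scom p q u v.
Proof. by rewrite /scom; case: (p && q); ncring. Qed.

Lemma scom_suml I (r : seq I) (F : I -> U) p q v :
  scom p q (\sum_(i <- r) F i) v = \sum_(i <- r) scom p q (F i) v.
Proof. by rewrite /scom mulr_suml !mulr_sumr -sumrB. Qed.

Lemma scom_sumr I (r : seq I) (F : I -> U) p q v :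
  scom p q v (\sum_(i <- r) F i) = \sum_(i <- r) scom p q v (F i).
Proof. by rewrite /scom mulr_suml !mulr_sumr -sumrB. Qed.

Lemma scom_signl p q (b : bool) u v :
  scom p q ((-1) ^+ b * u) v = (-1) ^+ b * scom p q u v.
Proof. by rewrite /scom; case: (p && q); case: b; ncring. Qed.

Lemma scom_signr p q (b : bool) u v :
  scom p q u ((-1) ^+ b * v) = (-1) ^+ b * scom p q u v.
Proof. by rewrite /scom; case: (p && q); case: b; ncring. Qed.

Lemma scom_x_gmx e i j (a b : idx) :
  scom e (a.1 (+) b.1) (x e i j) (gmx a b) =
  (-1) ^+ e * gmx (a.1 (+) e, i) b *+ (j == a.2)
  - (-1) ^+ (e && (a.1 (+) b.1)) * gmx a (b.1 (+) e, j) *+ (b.2 == i).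
Proof.
rewrite /gmx scom_signr x_br /=.
move: (j == a.2) (b.2 == i) => B C.
by move: e a.1 b.1 => [] [] []; ncring.
Qed.

Lemma sum_idx (F : idx -> U) : \sum_a F a = \sum_k (F (false, k) + F (true, k)).
Proof.
transitivity (\sum_(p : idx) F (p.1, p.2)); first by apply: eq_bigr => -[].
by rewrite -(pair_bigA _ (fun b k => F (b, k))) big_bool /= addrC big_split.
Qed.

Lemma sum_idx_eq (F : idx -> U) i :
  \sum_a F a *+ (a.2 == i) = F (false, i) + F (true, i).
Proof.
rewrite sum_idx (bigD1 i) //= eqxx big1 ?addr0 ?mulr1n // => k /negPf ->.
by rewrite addr0.
Qed.

(** Bracketing with a letter is a superderivation, so every factor of the power contributes. Where
    two factors meet, the term from the column of one and the term from the row of the next cancel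
    after flipping the sign of the summed index, and only the outer indices c and d are left. *)
Lemma scom_x_gpow m e i j (c d : idx) :
  scom e (c.1 (+) d.1) (x e i j) (gpow m c d) =
  (-1) ^+ e * gpow m c (d.1 (+) e, i) *+ (j == d.2)
  - (-1) ^+ (e && (c.1 (+) d.1)) * gpow m (c.1 (+) e, j) d *+ (c.2 == i).
Proof.
elim: m d => [|m IHm] d.
  case: c d => [c1 c2] [d1 d2]; rewrite /scom /= !xpair_eqE [j == d2]eq_sym.
  have [->|_] := eqVneq d2 j; have [->|_] := eqVneq c2 i; rewrite ?eqxx ?andbF ?andbT.
  - by have [<-|_] := eqVneq i j; move: c1 d1 e => [] [] [] /=; ncring.
  - by case: (c2 == j); move: c1 d1 e => [] [] [] /=; ncring.
  - by rewrite [i == d2]eq_sym; case: (d2 == i); move: c1 d1 e => [] [] [] /=; ncring.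
  - by case: (c2 == d2); move: c1 d1 e => [] [] [] /=; ncring.
rewrite !gpowS scomNr scom_sumr.
have {}IHm a : scom e (c.1 (+) d.1) (x e i j) (gmx d a * gpow m c a) =
   (-1) ^+ e * (gmx (d.1 (+) e, i) a * gpow m c a) *+ (j == d.2)
   - (-1) ^+ (e && (d.1 (+) a.1)) * (gmx d (a.1 (+) e, j) * gpow m c a) *+ (a.2 == i)
   - (-1) ^+ (e && (c.1 (+) d.1)) * (gmx d a * gpow m (c.1 (+) e, j) a) *+ (c.2 == i)
   + (-1) ^+ (e && ~~ (d.1 (+) a.1)) * (gmx d a * gpow m c (a.1 (+) e, i)) *+ (j == a.2).
  have -> : c.1 (+) d.1 = (d.1 (+) a.1) (+) (c.1 (+) a.1).
    by case: c.1 d.1 a.1 => -[] [].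
  rewrite scomMr scom_x_gmx IHm; move: e c.1 d.1 a.1 {IHm} => [] [] [] [];
  ncring.
rewrite (eq_bigr _ (fun a _ => IHm a)) {IHm} !big_split /= !sumrN !sumrMnl.
rewrite -!mulr_sumr.
rewrite (sum_idx_eq (fun a => (-1) ^+ (e && (d.1 (+) a.1)) * (gmx d (a.1 (+) e, j) *
  gpow m c a))).
under [X in _ + X]eq_bigr do rewrite eq_sym.
rewrite (sum_idx_eq (fun a => (-1) ^+ (e && ~~ (d.1 (+) a.1)) * (gmx d a * gpow m c
  (a.1 (+) e, i)))).
by rewrite /=; move: e c.1 d.1 => [] [] [] /=; ncring.
Qed.

(** * Supercommutators of two entries of powers *)

Definition theta (i k l : idx) : U :=
  (-1) ^+ ((i.1 && k.1) (+) (i.1 && l.1) (+) (k.1 && l.1)).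

(** By [scom_x_gpow] the bracket has two parts. One forces a to be l or -l and leaves products of
    two entries; the other contracts over a to one entry of the power p + q. The Kronecker deltas of
    the contracted part are written as [gpow 0], so that it has the shape of a product as well. *)
Lemma sum_gmx_scom p q (i j k l : idx) :
  \sum_a (-1) ^+ ((i.1 (+) a.1) && (k.1 (+) l.1)) *
    (scom (j.1 (+) a.1) (k.1 (+) l.1) (gmx j a) (gpow p k l) * gpow q i a) =
  theta i k l * (gpow p k j * gpow q i l
      - (-1) ^+ (k.1 (+) l.1) * (gpow p k (negi j) * gpow q i (negi l))
    - (gpow 0 k j * gpow (p + q) i l
      - (-1) ^+ (k.1 (+) l.1) * ((-1) ^+ odd q * (gpow 0 (negi k) j * gpow (p + q)
        (negi i) l)))).
Proof.
pose T1 a := (-1) ^+ ((i.1 (+) a.1) && (k.1 (+) l.1)) * ((-1) ^+ a.1 *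
  (gpow p k (l.1 (+) (j.1 (+) a.1), j.2) * gpow q i a)).
pose T2 a := gpow p (k.1 (+) (j.1 (+) a.1), a.2) l * gpow q i a.
pose s2 : U := (-1) ^+ (j.1 (+) ((i.1 (+) j.1) && (k.1 (+) l.1))).
transitivity (\sum_a T1 a *+ (a.2 == l.2) - s2 * (\sum_a T2 a) *+ (k.2 == j.2)).
  rewrite mulr_sumr -sumrMnl -sumrB; apply: eq_bigr => a _.
  rewrite scom_signl scom_x_gpow /T1 /T2 /s2.
  by move: i.1 j.1 k.1 l.1 a.1 => [] [] [] [] [] /=; ncring.
rewrite sum_idx_eq.
have T2E : \sum_a T2 a *+ (k.2 == j.2) = gpow 0 k j * gpow (p + q) i l
    + (-1) ^+ odd q * (gpow 0 (negi k) j * gpow (p + q) (negi i) l).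
  rewrite /= -!pair_eqE /pair_eq /=; have [_|_] := eqVneq k.2 j.2; last first.
    by rewrite sumrMnl !andbF !mul0r mulr0 addr0.
  rewrite !andbT sumrMnl mulr1n.
  have gpow_mulN : \sum_a gpow p (negi a) l * gpow q i a =
      (-1) ^+ odd q * gpow (p + q) (negi i) l.
    rewrite -gpow_mul mulr_sumr -[RHS]sum_negi; apply: eq_bigr => a _.
    by rewrite gpow_neg -[_ ^+ q]signr_odd signC mulrA -expr2 sqrr_sign mul1r.
  rewrite /T2; case: (eqVneq k.1 j.1) => [<-|/negPf kj].
    have -> : ~~ k.1 == k.1 = false by case: k.1.
    rewrite mul0r mulr0 addr0 mul1r -gpow_mul; apply: eq_bigr => -[a1 a2] _ /=.
    by rewrite addbA addbb.
  have -> : ~~ k.1 == j.1 by move: k.1 j.1 kj => [] [].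
  rewrite mul0r add0r mul1r -gpow_mulN; apply: eq_bigr => -[a1 a2] _ /=.
  by congr (gpow _ (_, _) _ * _); move: k.1 j.1 a1 kj => [] [] [].
rewrite -mulrnAr -sumrMnl T2E /T1 /s2 /theta.
case: i j k l {T1 T2 s2 T2E} => [i1 i2] [j1 j2] [k1 k2] [l1 l2] /=.
by rewrite /negi; move: i1 j1 k1 l1 (odd q) => [] [] [] [] [] /=; ncring.
Qed.

Lemma thetaK i k l (u : U) : theta i k l * (theta i k l * u) = u.
Proof. by rewrite mulrA -expr2 sqrr_sign mul1r. Qed.

Lemma scom_gpowS m r (i j k l : idx) :
  scom (i.1 (+) j.1) (k.1 (+) l.1) (gpow m.+1 i j) (gpow r k l) =
  - (\sum_a gmx j a * scom (i.1 (+) a.1) (k.1 (+) l.1) (gpow m i a) (gpow r k l))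
  - (\sum_a (-1) ^+ ((i.1 (+) a.1) && (k.1 (+) l.1)) *
    (scom (j.1 (+) a.1) (k.1 (+) l.1) (gmx j a) (gpow r k l) * gpow m i a)).
Proof.
rewrite gpowS scomNl scom_suml -opprD -big_split; congr (- _).
apply: eq_bigr => a _ /=; rewrite -scomMl; congr (scom _ _ _ _).
by move: i.1 j.1 a.1 => [] [] [].
Qed.

Lemma sum_gmx_gpow m k j (w : U) : \sum_a gmx j a * (gpow m k a * w) = - (gpow m.+1 k j
  * w).
Proof.
by rewrite gpowS mulNr opprK mulr_suml; apply: eq_bigr => a _; rewrite mulrA.
Qed.

Lemma sum_gmx_gpow_neg m k j (w : U) :
  \sum_a gmx j a * (gpow m k (negi a) * w) = gpow m.+1 k (negi j) * w.
Proof.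
rewrite gpowS mulNr mulr_suml -sumrN -[LHS]sum_negi; apply: eq_bigr => a _.
by rewrite negiK -[gmx j _]opprK -gmx_neg negiK mulNr mulrA.
Qed.

Definition gprod p q (i j k l : idx) := gpow p k j * gpow q i l.

Definition gprod_negl p q (i j k l : idx) := gpow p (negi k) j * gpow q (negi i) l.

Definition gprod_negr p q (i j k l : idx) := gpow p k (negi j) * gpow q i (negi l).

Lemma sum_gmx_scomE p q (i j k l : idx) :
  \sum_a (-1) ^+ ((i.1 (+) a.1) && (k.1 (+) l.1)) *
    (scom (j.1 (+) a.1) (k.1 (+) l.1) (gmx j a) (gpow p k l) * gpow q i a) =
  theta i k l * (gprod p q i j k l - gprod 0 (p + q) i j k l
    + (-1) ^+ (k.1 (+) l.1) * ((-1) ^+ odd q * gprod_negl 0 (p + q) i j k l -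
      gprod_negr p q i j k l)).
Proof.
rewrite sum_gmx_scom -/(gprod _ _ _ _ _ _) -/(gprod_negl _ _ _ _ _ _) -/(gprod_negr _ _
  _ _ _ _).
rewrite -/(gprod _ _ _ _ _ _); congr (_ * _).
by case: (odd q) (k.1 (+) l.1) => [] [] /=; ncring.
Qed.

Lemma scom_gpow1 r (i j k l : idx) :
  scom (i.1 (+) j.1) (k.1 (+) l.1) (gpow 1 i j) (gpow r k l) =
  theta i k l * (gprod 0 r i j k l - gprod r 0 i j k l
    + (-1) ^+ (k.1 (+) l.1) * (- gprod_negl 0 r i j k l + gprod_negr r 0 i j k l)).
Proof.
rewrite scom_gpowS sum_gmx_scomE addn0 big1 => [|a _]; last first.
  rewrite /scom /=; case: (eqVneq i a) => [<-|_]; last by rewrite !(mul0r, mulr0, subr0).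
  by rewrite addbb mul1r mulr1 mul1r subrr mulr0.
rewrite oppr0 add0r -mulrN; congr (_ * _).
by move: (_ (+) _) => [] /=; ncring.
Qed.

(* Induction on m, pulling one factor of [gmx] out of [gpow m.+1 i j]: the sums
   over the column of that factor that come with [gpow (r + m)] are the same for
   both commutators and cancel. *)
Theorem gpow_relation m r (i j k l : idx) :
  theta i k l *
   (scom (i.1 (+) j.1) (k.1 (+) l.1) (gpow m.+2 i j) (gpow r k l)
    - scom (i.1 (+) j.1) (k.1 (+) l.1) (gpow m i j) (gpow r.+2 k l)) =
  gprod m.+1 r i j k l + gprod m r.+1 i j k l
  - gprod r m.+1 i j k l - gprod r.+1 m i j k l
  + (-1) ^+ (k.1 (+) l.1) *
    (- gprod_negl m.+1 r i j k l + gprod_negl m r.+1 i j k l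
     + gprod_negr r m.+1 i j k l - gprod_negr r.+1 m i j k l).
Proof.
elim: m j => [|m IHm] j; have sumPQQ p q : \sum_a gmx j a * gprod p q i a k l = - gprod
  p.+1 q i j k l.
1, 3: exact: sum_gmx_gpow.
all: have sumPQQn p q : \sum_a gmx j a * gprod_negl p q i a k l = - gprod_negl p.+1 q i
  j k l.
1, 3: exact: sum_gmx_gpow.
all: have sumPQQnr p q : \sum_a gmx j a * gprod_negr p q i a k l = gprod_negr p.+1 q i
  j k l.
1, 3: exact: sum_gmx_gpow_neg.
  have -> : scom (i.1 (+) j.1) (k.1 (+) l.1) (gpow 0 i j) (gpow r.+2 k l) = 0.
    rewrite /scom /=; case: (eqVneq i j) => [<-|_]; last by rewrite !(mul0r, mulr0, subr0).
    by rewrite addbb mul1r mulr1 mul1r subrr.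
  rewrite subr0 scom_gpowS sum_gmx_scomE.
  under eq_bigr do rewrite scom_gpow1 /theta signC.
  rewrite -mulr_sumr -mulrN -mulrBr thetaK addn1.
  under eq_bigr do rewrite !(mulrDr, mulrN, signC).
  rewrite !(big_split, sumrN) /= -!mulr_sumr !(sumPQQ, sumPQQn, sumPQQnr).
  by case: (k.1 (+) l.1); ncring.
transitivity (- (\sum_a gmx j a * (gprod m.+1 r i a k l + gprod m r.+1 i a k l
      - gprod r m.+1 i a k l - gprod r.+1 m i a k l
      + (-1) ^+ (k.1 (+) l.1) * (- gprod_negl m.+1 r i a k l + gprod_negl m r.+1 i a k l
      + gprod_negr r m.+1 i a k l - gprod_negr r.+1 m i a k l)))
   - (gprod r m.+2 i j k l - gprod r.+2 m i j k l
      - (-1) ^+ (k.1 (+) l.1) * (gprod_negr r m.+2 i j k l - gprod_negr r.+2 m i j k l))).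
  under eq_bigr do rewrite -IHm signC.
  rewrite -mulr_sumr -[X in _ - X](thetaK i k l) -mulrN -mulrBr; congr (_ * _).
  rewrite !scom_gpowS !sum_gmx_scomE !addnS !addSn /= negbK /theta.
  under [X in _ = - X - _]eq_bigr do rewrite mulrBr.
  rewrite sumrB; move: (\sum_a _) (\sum_a _) => X Y.
  case: (k.1 (+) l.1) (odd m) (_ (+) _) => [] [] []; ncring.
under eq_bigr do rewrite !(mulrDr, mulrN, signC).
rewrite !(big_split, sumrN) /= -!mulr_sumr !(sumPQQ, sumPQQn, sumPQQnr).
by case: (k.1 (+) l.1); ncring.
Qed.

(* Shifting the exponent by s multiplies the symmetry of [gpow] under [negi] by
   (-1)^s; the sign depending on the row restores it. *)
Definition gtwist (s m : nat) (i j : idx) : U :=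
  (-1) ^+ (odd s && ~~ j.1) * gpow (s + m) i j.

Lemma gtwist_relation s m r (i j k l : idx) :
  theta i k l *
   (scom (i.1 (+) j.1) (k.1 (+) l.1) (gtwist s m.+2 i j) (gtwist s r k l)
    - scom (i.1 (+) j.1) (k.1 (+) l.1) (gtwist s m i j) (gtwist s r.+2 k l)) =
  gtwist s m.+1 k j * gtwist s r i l + gtwist s m k j * gtwist s r.+1 i l
  - gtwist s r k j * gtwist s m.+1 i l - gtwist s r.+1 k j * gtwist s m i l
  + (-1) ^+ (k.1 (+) l.1) *
    (- (gtwist s m.+1 (negi k) j * gtwist s r (negi i) l)
     + gtwist s m (negi k) j * gtwist s r.+1 (negi i) l
     + gtwist s r k (negi j) * gtwist s m.+1 i (negi l)
     - gtwist s r.+1 k (negi j) * gtwist s m i (negi l)).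
Proof.
move: (gpow_relation (s + m) (s + r) i j k l).
rewrite /gtwist /gprod /gprod_negl /gprod_negr /scom /theta !addnS.
case: i j k l => [i a] [j b] [k c] [l d]; rewrite /negi /=.
generalize gpow => q; move: (odd s) => os.
(* All products in the relation carry this same sign: their second indices are j and l, or -j and
   -l. *)
move=> /(congr1 ( *%R ((-1) ^+ (os && (j (+) l))))).
case: i; case: j; case: k; case: l; case: os => /=;
  match goal with |- ?a = _ -> _ = _ =>
    move=> rel; transitivity a; [ncring | rewrite rel; ncring]
  end.
Qed.

End Sergeev.

(** * Filtration of U / I_chi *)

Section Whittaker.
Variables (K : fieldType) (n' : nat).
Local Notation n := n'.+1.
Variables (U : algType K) (x : bool -> 'I_n -> 'I_n -> U).

Hypothesis x_br : forall e d i j k l, scom e d (x e i j) (x d k l) =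
  x (e (+) d) i l *+ (j == k) - (-1) ^+ (e && d) * x (e (+) d) k j *+ (l == i).

Definition chiv (e : bool) (i j : 'I_n) : K := (~~ e && (i == j.+1 :> nat))%:R.

(* Locked, lest rewriting with additive laws unfold it. *)
Definition xbar e i j : U := locked (x e i j - (chiv e i j)%:A).

Lemma xbarE e i j : xbar e i j = x e i j - (chiv e i j)%:A.
Proof. by rewrite /xbar -lock. Qed.

Inductive Ichi : U -> Prop :=
  | Ichi_0 : Ichi 0
  | Ichi_D u v : Ichi u -> Ichi v -> Ichi (u + v)
  | Ichi_gen u e (i j : 'I_n) : (j < i)%N -> Ichi (u * xbar e i j).

Lemma Ichi_Ml v u : Ichi u -> Ichi (v * u).
Proof.
elim=> [|u1 u2 _ ? _ ?|u1 e i j ij]; first by rewrite mulr0; apply: Ichi_0.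
  by rewrite mulrDr; apply: Ichi_D.
by rewrite mulrA; apply: Ichi_gen.
Qed.

Lemma Ichi_Z c u : Ichi u -> Ichi (c *: u).
Proof. by move=> Ju; rewrite -mulr_algl; apply: Ichi_Ml. Qed.

Lemma Ichi_N u : Ichi u -> Ichi (- u).
Proof. by move=> Ju; rewrite -scaleN1r; apply: Ichi_Z. Qed.

Lemma Ichi_B u v : Ichi u -> Ichi v -> Ichi (u - v).
Proof. by move=> Ju Jv; apply: Ichi_D => //; apply: Ichi_N. Qed.

(* A variant of the Kazhdan degree, chosen so that a bracket has degree one less
   than the corresponding product.  The associated graded algebra is then
   supercommutative, and in it a lower letter shifted by its character acts as a
   derivation with constant coefficients. *)
Definition ldeg (i j : nat) : int := (j%:Z - i%:Z) * 2 + 1.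

(** Only upper triangular letters generate the filtration, which makes [filt_neg] immediate; that
    lower letters respect it is proved in [filt_xbar]. *)
Inductive filt : int -> U -> Prop :=
  | filt_J w u : Ichi u -> filt w u
  | filt_1 w : 0 <= w -> filt w 1
  | filt_D w u v : filt w u -> filt w v -> filt w (u + v)
  | filt_Z w c u : filt w u -> filt w (c *: u)
  | filt_x w e (i j : 'I_n) u : (i <= j)%N -> filt (w - ldeg i j) u -> filt w (x e i j * u).

Lemma filt_mono w w' u : w <= w' -> filt w u -> filt w' u.
Proof.
move=> + Fu; elim: Fu w' => [{}w {}u ? w' _|{}w ? w' ?|{}w u1 u2 _ IH1 _ IH2 w' ?|
  {}w c {}u _ IH w' ?|{}w e i j {}u ij _ IH w' ?].
- exact: filt_J.
- by apply: filt_1; lia.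
- by apply: filt_D; [apply: IH1|apply: IH2].
- exact/filt_Z/IH.
- by apply: filt_x => //; apply: IH; lia.
Qed.

Lemma filt_0 w : filt w 0. Proof. exact/filt_J/Ichi_0. Qed.

Lemma filt_N w u : filt w u -> filt w (- u).
Proof. by move=> ?; rewrite -scaleN1r; apply: filt_Z. Qed.

Lemma filt_B w u v : filt w u -> filt w v -> filt w (u - v).
Proof. by move=> ? ?; apply: filt_D => //; apply: filt_N. Qed.

Lemma filt_sign w (b : bool) u : filt w u -> filt w ((-1) ^+ b * u).
Proof. by case: b => Fu; rewrite ?mulN1r ?mul1r //; apply: filt_N. Qed.

Lemma filt_sum w I (r : seq I) (p : pred I) (f : I -> U) :
  (forall i, p i -> filt w (f i)) -> filt w (\sum_(i <- r | p i) f i).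
Proof. by move=> Ff; apply: big_ind => //; [apply: filt_0|apply: filt_D]. Qed.

(** Upper letters have positive degree, so the unit never occurs in negative degree. Every passage
    from smaller degree to a congruence modulo I_chi goes through this. *)
Lemma filt_neg w u : w < 0 -> filt w u -> Ichi u.
Proof.
move=> + Fu; elim: Fu => [//|{}w ? ?|{}w u1 u2 _ IH1 _ IH2 ?|{}w c {}u _ IH ?|
  {}w e i j {}u ij _ IH ?].
- by exfalso; lia.
- by apply: Ichi_D; [apply: IH1|apply: IH2].
- exact/Ichi_Z/IH.
- by apply/Ichi_Ml/IH; rewrite /ldeg; lia.
Qed.

(** The value of chi on the bracket: the constant that appears when the bracket of shifted letters
    is written in shifted letters. *)
Definition chibr e d (i j k l : 'I_n) : K :=
  chiv (e (+) d) i l *+ (j == k) - (-1) ^+ (e && d) * chiv (e (+) d) k j *+ (l == i).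

Lemma chiv_upper e (i j : 'I_n) : (i <= j)%N -> chiv e i j = 0.
Proof. by move=> ij; rewrite /chiv; case: eqP => [|_]; [lia | rewrite andbF]. Qed.

Lemma xbar_upper e (i j : 'I_n) : (i <= j)%N -> xbar e i j = x e i j.
Proof. by move=> ij; rewrite xbarE chiv_upper // scale0r subr0. Qed.

Lemma xbar_com e d i j k l : xbar e i j * xbar d k l =
  (-1) ^+ (e && d) * (xbar d k l * xbar e i j)
  + xbar (e (+) d) i l *+ (j == k) - (-1) ^+ (e && d) * xbar (e (+) d) k j *+ (l == i)
  + (chibr e d i j k l)%:A.
Proof.
have /(canRL (subrK _)) xx := x_br e d i j k l.
rewrite /chibr !xbarE !mulrBl !mulrBr xx !mulr_algl !mulr_algr {xx}.
have -> : chiv e i j *: (chiv d k l)%:A = chiv d k l *: (chiv e i j)%:A :> U.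
  by rewrite !scalerA mulrC.
have chr1 p q : chiv true p q = 0 by [].
case: e; case: d; rewrite /= ?chr1 ?expr0 ?expr1 ?mulN1r ?mul1r ?mul0rn ?mulr0.
all: rewrite ?mulNrn ?scalerBl ?scaleNr -?scalerMnl ?scale0r ?scaler0 ?scale1r; ncring.
Qed.

Lemma Ichi_xbar e (i j : 'I_n) c : (j < i)%N -> Ichi (xbar e i j * c%:A).
Proof. by move=> ij; rewrite mulr_algr -[xbar _ _ _]mul1r; apply/Ichi_Z/Ichi_gen. Qed.

(** A lower letter is moved to the right until it meets 1 and falls into I_chi. On the way, brackets
    lose one degree, and the constant [chibr] is nonzero only if the two letters have opposite
    degrees, so it stays within the bound. *)
Lemma filt_xbar w e (i j : 'I_n) u : filt w u -> filt (w + ldeg i j) (xbar e i j * u).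
Proof.
move=> Fu; have [ij|ij] := leqP i j.
  by rewrite xbar_upper //; apply: filt_x => //; rewrite addrK.
move: e i j ij; elim: Fu => {w u}
  [w u Ju|w w0|w u v _ IH1 _ IH2|w c u _ IH|w d k l u kl Fu IH] e i j ij.
- exact/filt_J/Ichi_Ml.
- by have := Ichi_xbar e 1 ij; rewrite scale1r => /filt_J.
- by rewrite mulrDr; apply: filt_D; [apply: IH1|apply: IH2].
- by rewrite -scalerAr; apply/filt_Z/IH.
have IH' e' (i' j' : 'I_n) : filt (w - ldeg k l + ldeg i' j') (xbar e' i' j' * u).
  have [?|?] := leqP i' j'; last exact: IH.
  by rewrite xbar_upper //; apply: filt_x => //; rewrite addrK.
rewrite -(xbar_upper d kl) mulrA xbar_com !mulrDl mulNr !mulrnAl -!mulrA.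
apply: filt_D; [apply: filt_D; [apply: filt_D|]|].
- rewrite (xbar_upper d kl); apply/filt_sign/filt_x => //.
  by apply: filt_mono (IH' e i j); rewrite /ldeg; lia.
- have [jk|] := eqVneq j k; last by move=> _; apply: filt_0.
  by apply: filt_mono (IH' (e (+) d) i l); rewrite -jk /ldeg; lia.
- apply: filt_N; have [li|] := eqVneq l i; last by move=> _; apply: filt_0.
  by apply: filt_sign; apply: filt_mono (IH' (e (+) d) k j); rewrite -li /ldeg; lia.
rewrite mulr_algl /chibr scalerBl; apply: filt_B.
  rewrite -scalerMnl; have [jk|] := eqVneq j k; last by move=> _; apply: filt_0.
  rewrite /chiv; case: andP => [[_ /eqP il]|_]; last by rewrite scale0r; apply: filt_0.
  by apply: filt_Z; apply: filt_mono Fu; rewrite /ldeg -jk il; lia.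
rewrite -scalerMnl; have [li|] := eqVneq l i; last by move=> _; apply: filt_0.
rewrite -scalerA; apply: filt_Z.
rewrite /chiv; case: andP => [[_ /eqP kj]|_]; last by rewrite scale0r; apply: filt_0.
by apply: filt_Z; apply: filt_mono Fu; rewrite /ldeg -li kj; lia.
Qed.

Lemma filt_com w e d (i j k l : 'I_n) u : filt w u ->
  filt (w + ldeg i j + ldeg k l - 1)
    ((xbar e i j * xbar d k l - (-1) ^+ (e && d) * (xbar d k l * xbar e i j)
      - (chibr e d i j k l)%:A) * u).
Proof.
move=> Fu; rewrite xbar_com.
set s := _ * (_ * _); set t := _ *+ _; set t' := _ *+ _; set c := _%:A.
have -> : (s + t - t' + c - s - c) * u = t * u - t' * u by ncring.
rewrite /t /t' {s t t' c}; apply: filt_B; rewrite mulrnAl.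
  have [jk|] := eqVneq j k; last by move=> _; apply: filt_0.
  by apply: filt_mono (filt_xbar (e (+) d) i l Fu); rewrite -jk /ldeg; lia.
have [li|] := eqVneq l i; last by move=> _; apply: filt_0.
by rewrite -mulrA; apply: filt_sign; apply: filt_mono (filt_xbar (e (+) d) k j Fu);
  rewrite -li /ldeg; lia.
Qed.

(** * Coordinates of the upper triangular part and their dual operators *)

Definition qletter := (bool * 'I_n * 'I_n)%type.
Implicit Types (b c : qletter).

Definition upper c := (c.1.2 <= c.2)%N.

Definition qdeg c := ldeg c.1.2 c.2.

Definition altsgn (e : bool) (s : nat) : K := (-1) ^+ (e && odd s).

(* Signed partial sums along a diagonal.  Under the pairing (a, y) |-> chi [a, y]
   those with c.2 < n' are dual to the operators [dualop], while those in the last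
   column span the centralizer of the nilpotent E. *)
Definition ycoord c : U :=
  \sum_(s < n | (s <= c.1.2)%N)
    altsgn c.1.1 s *: x c.1.1 s (inord (s + (c.2 - c.1.2))).

Definition ytype c := upper c && (c.2 < n')%N.

(** If [ytype c], then c.2 + 1 is in range and the letter is lower triangular of degree
    [- qdeg c]. *)
Definition dualop c : U := xbar c.1.1 (inord c.2.+1) c.1.2.

Definition kappa b c : K := if b == c then altsgn b.1.1 b.1.2 else 0.

Lemma sum_delta (f : 'I_n -> K) (k i : nat) :
  \sum_(s < n | (s <= k)%N) f s *+ (s == i :> nat) =
  if ((i <= k) && (i < n))%N then f (inord i) else 0.
Proof.
case: ifP => [/andP[ik ltin]|ikF].
  rewrite (bigD1 (inord i)) /= ?inordK // eqxx big1 ?addr0 // => s /andP[_].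
  by rewrite -val_eqE /= inordK // => /negPf ->.
rewrite big1 // => s sk; case: eqP => // si; move: ikF; rewrite -si sk.
by rewrite ltn_ord.
Qed.

(** On its own diagonal a dual operator pairs nontrivially only with the letters in rows s = i and s
    = i + 1, and the two contributions cancel. A partial sum up to row k contains both if k > i and
    neither if k < i, so it contributes exactly when k = i. *)
Lemma chibr_sum b c : ytype b -> upper c ->
  \sum_(s < n | (s <= c.1.2)%N) altsgn c.1.1 s *
    chibr b.1.1 c.1.1 (inord b.2.+1) b.1.2 s (inord (s + (c.2 - c.1.2))) = kappa b c.
Proof.
case: b c => [[e i] j] [[d k] l] /andP[/= ij ljn]; rewrite /upper /kappa /chibr /= => kl.
have vj : val (inord j.+1 : 'I_n) = j.+1 by rewrite /= inordK.
have [<-{d}|ed] := eqVneq e d; last first.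
  rewrite big1 ?xpair_eqE ?(negPf ed) // => s _.
  have chr1 p q : chiv true p q = 0 by [].
  have -> : e (+) d = true by move: ed; clear; case: e; case: d.
  by rewrite !chr1 mulr0 !mul0rn subr0 mulr0.
rewrite addbb !xpair_eqE eqxx andbb /=.
pose cond := (j == i + (l - k) :> nat)%N.
transitivity (\sum_(s < n | (s <= k)%N)
   ((altsgn e s *+ cond) *+ (s == i :> nat)
    - ((-1) ^+ e * altsgn e s *+ cond) *+ (s == i.+1 :> nat))).
  apply: eq_bigr => s sk; rewrite /chiv /=.
  have slk : (s + (l - k) < n)%N by move: (ltn_ord l); lia.
  rewrite -[i == s]val_eqE -[_ == inord j.+1]val_eqE /= !inordK //.
  rewrite -mulrnAr -!mulrnA !mulnb.
  have -> : (j.+1 == (s + (l - k)).+1)%N && (i == s :> nat) = cond && (s == i :> nat).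
    by rewrite /cond; apply/andP/andP => -[/eqP ? /eqP ?]; split; apply/eqP; lia.
  have -> : (s == i.+1 :> nat) && (s + (l - k) == j.+1)%N = cond && (s == i.+1 :> nat).
    by rewrite /cond; apply/andP/andP => -[/eqP ? /eqP ?]; split; apply/eqP; lia.
  by rewrite mulrBr mulr_natr mulrCA mulrA mulr_natr.
rewrite sumrB !sum_delta (leq_ltn_trans ij (ltn_ord j)) andbT inord_val.
have -> : (i == k) && (j == l) = cond && (i == k).
  rewrite -!val_eqE /cond /=; move: (ij); rewrite /upper /= => ?.
  by apply/andP/andP => -[/eqP ? /eqP ?]; split; apply/eqP; lia.
rewrite /cond; case: (eqVneq (j : nat) _) => /= [_|_]; last by rewrite !mulr0n !if_same
  subr0.
rewrite !mulr1n -val_eqE /=.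
have ikn : (i.+1 <= k -> i.+1 < n)%N by move: (ltn_ord k); lia.
have [ik|ki] := ltnP i k.
  rewrite ikn // inordK ?ikn // ltnW // (ltn_eqF ik) /altsgn /=.
  by case: (e); rewrite /= ?expr0 ?expr1 ?mul1r ?subrr // signrN mulN1r opprK subrr.
by rewrite andFb subr0; case: ifP; case: eqP => //; lia.
Qed.

Lemma y_upper_le c (s : 'I_n) : upper c -> (s <= c.1.2)%N -> (s + (c.2 - c.1.2) < n)%N.
Proof. by rewrite /upper => ? ?; move: (ltn_ord c.2); lia. Qed.

(** In the graded algebra this says that [dualop b] is a superderivation with value [kappa b c] on
    the coordinate c. *)
Lemma filt_dualop_ycoord w b c u : ytype b -> upper c -> filt w u ->
  filt (w - qdeg b + qdeg c - 1)
    ((dualop b * ycoord c - (-1) ^+ (b.1.1 && c.1.1) * (ycoord c * dualop b) - (kappa b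
      c)%:A) * u).
Proof.
move=> yb uc Fu; rewrite -chibr_sum //.
rewrite /ycoord mulr_sumr mulr_suml mulr_sumr scaler_suml -!sumrB mulr_suml.
apply: filt_sum => s sc.
rewrite -scalerAr -!scalerAl -scalerAr -scalerBr -scalerA -scalerBr -scalerAl.
apply: filt_Z; rewrite -xbar_upper ?inordK ?y_upper_le ?leq_addr //.
move: yb; rewrite /ytype => /andP[ub bn].
apply: filt_mono (filt_com _ _ _ _ _ _ Fu); rewrite /qdeg /ldeg !inordK ?y_upper_le //.
by move: uc ub; rewrite /upper; lia.
Qed.

Lemma filt_ycoord w c u : upper c -> filt w u -> filt (w + qdeg c) (ycoord c * u).
Proof.
move=> uc Fu; rewrite /ycoord mulr_suml; apply: filt_sum => s sc.
rewrite -scalerAl; apply: filt_Z; rewrite -xbar_upper ?inordK ?y_upper_le ?leq_addr //.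
by apply: filt_mono (filt_xbar _ _ _ Fu); rewrite /qdeg /ldeg inordK ?y_upper_le //;
  move: uc; rewrite /upper; lia.
Qed.

Lemma filt_dualop w c u : ytype c -> filt w u -> filt (w - qdeg c) (dualop c * u).
Proof.
move=> /andP[uc cn] Fu; apply: filt_mono (filt_xbar _ _ _ Fu).
by rewrite /qdeg /ldeg inordK; lia.
Qed.

Lemma chibr_upper e d (i j k l : 'I_n) : (i <= j)%N -> (k <= l)%N -> chibr e d i j k l = 0.
Proof.
move=> ij kl; rewrite /chibr; have [jk|_] := eqVneq j k.
  rewrite chiv_upper ?mul0rn; last by rewrite (leq_trans ij) // jk.
  have [li|_] := eqVneq l i; last by rewrite mulr0n subr0.
  by rewrite chiv_upper ?mulr0 ?mul0rn ?subr0 // (leq_trans kl) // li.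
rewrite mulr0n; have [li|_] := eqVneq l i; last by rewrite mulr0n subr0.
by rewrite chiv_upper ?mulr0 ?mul0rn ?subr0 // (leq_trans kl) // li.
Qed.

Lemma filt_ycoord_com w b c u : upper b -> upper c -> filt w u ->
  filt (w + qdeg b + qdeg c - 1)
    ((ycoord b * ycoord c - (-1) ^+ (b.1.1 && c.1.1) * (ycoord c * ycoord b)) * u).
Proof.
move=> ub uc Fu; rewrite /ycoord; set eb := b.1.1; set ec := c.1.1.
rewrite !big_distrlr /= [X in _ - _ * X]exchange_big /= mulr_sumr -sumrB mulr_suml.
apply: filt_sum => s sb; rewrite mulr_sumr -sumrB mulr_suml.
apply: filt_sum => t tc.
rewrite -!(scalerAl, scalerAr) !scalerA [altsgn ec t * _]mulrC -scalerBr -scalerAl.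
apply: filt_Z; rewrite -!xbar_upper ?inordK ?y_upper_le ?leq_addr //.
have := filt_com eb ec s (inord (s + (b.2 - b.1.2))) t (inord (t + (c.2 - c.1.2))) Fu.
rewrite chibr_upper ?inordK ?y_upper_le ?leq_addr // scale0r subr0.
apply: filt_mono; rewrite /qdeg /ldeg.
by move: ub uc; rewrite /upper; lia.
Qed.

(** * Ordered monomials *)

Definition ymon (s : seq qletter) : U := foldr (fun c u => ycoord c * u) 1 s.

Definition wt (s : seq qletter) : int := \sum_(c <- s) qdeg c.

Lemma wt_cons c s : wt (c :: s) = qdeg c + wt s.
Proof. by rewrite /wt big_cons. Qed.

Lemma wt_perm s t : perm_eq s t -> wt s = wt t.
Proof. exact: perm_big. Qed.

Lemma mon_cat s t : ymon (s ++ t) = ymon s * ymon t.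
Proof. by elim: s => [|c s IHs] /=; rewrite ?mul1r // IHs mulrA. Qed.

Lemma qdeg_gt0 c : upper c -> 0 < qdeg c.
Proof. by rewrite /upper /qdeg /ldeg; lia. Qed.

Lemma wt_ge0 s : all upper s -> 0 <= wt s.
Proof.
elim: s => [|c s IHs] /=; first by rewrite /wt big_nil.
by rewrite wt_cons => /andP[/qdeg_gt0 ? /IHs ?]; lia.
Qed.

Lemma filt_monl w s u : all upper s -> filt w u -> filt (w + wt s) (ymon s * u).
Proof.
move=> + Fu; elim: s => [|c s IHs] /=; first by rewrite /wt big_nil addr0 mul1r.
move=> /andP[uc us]; rewrite wt_cons -mulrA addrCA addrC.
by apply: filt_ycoord => //; apply: IHs.
Qed.

Lemma filt_mon s : all upper s -> filt (wt s) (ymon s).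
Proof. by move=> us; rewrite -[ymon s]mulr1 -[wt s]add0r; apply/filt_monl/filt_1. Qed.

(* Letters of the last column come last, so that in a sorted monomial they stand
   next to the factor from the image of the Yangian that replaces them. *)
Definition qkey c : nat := (c.2 * n + c.1.2) * 2 + c.1.1.

Lemma qkey_inj : injective qkey.
Proof.
move=> [[e i] j] [[d k] l]; rewrite /qkey /= => eqk.
have [ed ekl] : (e = d) /\ (j * n + i = l * n + k)%N.
  by move: eqk; case: e; case: d => /= ?; split=> //; lia.
have jl : j = l.
  by apply: val_inj; move: (congr1 (divn^~ n) ekl); rewrite /= !divnMDl // !divn_small
    // !addn0.
by rewrite ed jl in ekl *; congr (_, _, _); apply: val_inj; move/addnI: ekl.
Qed.

(* Strict on odd letters, whose squares have smaller degree. *)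
Definition ltk c d := (qkey c < qkey d)%N || ((c == d) && ~~ c.1.1).

Lemma ltk_trans : transitive ltk.
Proof.
move=> c b d /orP[bc|/andP[/eqP-> //]] /orP[cd|/andP[/eqP <- _]].
  by rewrite /ltk (ltn_trans bc cd).
by rewrite /ltk bc.
Qed.

Lemma ltk_anti : antisymmetric ltk.
Proof. by move=> c d; rewrite /ltk => /andP[/orP[cd|/andP[/eqP]//]
  /orP[dc|/andP[/eqP]//]]; lia. Qed.

Lemma ltk_qkey c d : ltk c d -> (qkey c <= qkey d)%N.
Proof. by move=> /orP[/ltnW//|/andP[/eqP->]]. Qed.

Hypothesis char0 : [pchar K] =i pred0.

Lemma natK_eq0 m : ((m%:R == 0 :> K) = (m == 0%N)).
Proof. by move/pcharf0P: char0 => ->. Qed.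

Lemma mon_insert c t : upper c -> all upper t -> sorted ltk t ->
  filt (wt (c :: t) - 1) (ymon (c :: t)) \/
  exists a t', [/\ sorted ltk t', perm_eq t' (c :: t)
    & filt (wt (c :: t) - 1) (ymon (c :: t) - a *: ymon t')].
Proof.
move=> uc; elim: t => [|d t IHt] /=.
  move=> _ _; right; exists 1, [:: c]; split=> //; rewrite scale1r subrr; exact: filt_0.
move=> /andP[ud ut] dt.
have [cd|] := boolP (ltk c d).
  right; exists 1, [:: c, d & t]; split=> //=; first by rewrite cd.
  by rewrite scale1r subrr; apply: filt_0.
rewrite negb_or negb_and negbK -leqNgt => /andP[].
have Ft := filt_mon ut.
rewrite !wt_cons; have [<-{d ud dt} _ /= oddc|cd dc _] := eqVneq c d.
  (* For an odd letter the supercommutator with itself is twice its square, so the square drops in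
     degree. *)
  left; have := filt_ycoord_com uc uc Ft; rewrite oddc expr1 mulN1r opprK => Fcc.
  have -> : ycoord c * (ycoord c * ymon t) = 2^-1 *: ((ycoord c * ycoord c + ycoord c *
    ycoord c) * ymon t).
    rewrite -mulr2n mulrnAl mulrA -scaler_nat scalerA mulVf ?scale1r //.
    by rewrite natK_eq0.
  by apply/filt_Z/filt_mono/Fcc; lia.
have ltdc : ltk d c.
  by rewrite /ltk ltn_neqAle dc andbT; rewrite (inj_eq qkey_inj) eq_sym cd.
set s : K := (-1) ^+ (c.1.1 && d.1.1).
have com : filt (qdeg c + (qdeg d + wt t) - 1) (ycoord c * (ycoord d * ymon t) - s *:
  (ycoord d * (ycoord c * ymon t))).
  have := filt_ycoord_com uc ud Ft; rewrite mulrBl -!mulrA /s.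
  case: (_ && _); rewrite ?expr1 ?expr0 ?mulN1r ?mul1r ?scaleN1r ?scale1r; apply:
    filt_mono; lia.
have up w v : filt w v -> filt (w + qdeg d) (ycoord d * v) by exact: filt_ycoord.
case: (IHt ut (path_sorted dt)) => [/up Fl|[a [t' [st' pt' Fr]]]].
  left; rewrite -[ycoord c * _](subrK (s *: (ycoord d * (ycoord c * ymon t)))).
  by apply: filt_D => //; apply: filt_Z; apply: filt_mono Fl; rewrite wt_cons; lia.
right; exists (s * a), (d :: t'); split.
- rewrite /= path_min_sorted //; rewrite (perm_all _ pt') /= ltdc /=.
  exact: order_path_min ltk_trans dt.
- rewrite -(perm_cons d) in pt'; apply: perm_trans pt' _.
  exact/permPl/(perm_catCA [:: d] [:: c] t).
have {Fr} := up _ _ Fr; rewrite mulrBr -scalerAr wt_cons /= => Fr.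
rewrite -[ycoord c * _](subrK (s *: (ycoord d * (ycoord c * ymon t)))) -[_ - _ + _ -
  _]addrA; apply: filt_D => //.
rewrite -scalerA -scalerBr; apply: filt_Z; apply: filt_mono Fr; lia.
Qed.

Lemma mon_sort s : all upper s ->
  filt (wt s - 1) (ymon s) \/
  exists a t, [/\ sorted ltk t, perm_eq t s & filt (wt s - 1) (ymon s - a *: ymon t)].
Proof.
elim: s => [_|c s IHs /= /andP[uc us]].
  right; exists 1, [::]; split=> //; rewrite scale1r subrr; exact: filt_0.
have up v : filt (wt s - 1) v -> filt (wt (c :: s) - 1) (ycoord c * v).
  by move=> /(filt_ycoord uc); apply: filt_mono; rewrite wt_cons; lia.
case: (IHs us) => [/up|[a [t [st pt Ft]]]]; first by left.
have ut : all upper t by rewrite (perm_all _ pt).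
have wtE : wt (c :: s) = wt (c :: t) by rewrite !wt_cons (wt_perm pt).
have Fct : filt (wt (c :: s) - 1) (ycoord c * ymon s - a *: (ycoord c * ymon t)).
  by rewrite scalerAr -mulrBr; apply: up.
case: (mon_insert uc ut st) => [Fi|[a' [t' [st' pt' Ft']]]].
  left; rewrite -[ycoord c * _](subrK (a *: (ycoord c * ymon t))); apply: filt_D => //.
  by apply: filt_Z; rewrite wtE.
right; exists (a * a'), t'; split=> //.
  by rewrite (perm_trans pt') // perm_cons.
rewrite -[ycoord c * _](subrK (a *: (ycoord c * ymon t))) -[_ - _ + _ - _]addrA; apply:
  filt_D => //.
by rewrite -scalerA -scalerBr; apply: filt_Z; rewrite wtE.
Qed.

(** * Iterated dual operators *)

Definition dualops (s : seq qletter) (u : U) : U := foldl (fun v c => dualop c * v) u s.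

Lemma dualopsD s u v : dualops s (u + v) = dualops s u + dualops s v.
Proof. by elim: s u v => [|c s IHs] u v //=; rewrite mulrDr IHs. Qed.

Lemma dualopsZ s a u : dualops s (a *: u) = a *: dualops s u.
Proof. by elim: s u => [|c s IHs] u //=; rewrite -scalerAr IHs. Qed.

Lemma dualopsMr s u v : dualops s (u * v) = dualops s u * v.
Proof. by elim: s u => [|c s IHs] u //=; rewrite mulrA IHs. Qed.

Lemma dualops_sum s (I : eqType) (r : seq I) (f : I -> U) :
  dualops s (\sum_(i <- r) f i) = \sum_(i <- r) dualops s (f i).
Proof.
elim: r => [|i r IHr]; last by rewrite !big_cons dualopsD IHr.
by rewrite !big_nil -(scale0r (1 : U)) dualopsZ !scale0r.
Qed.

Lemma Ichi_dualops s u : Ichi u -> Ichi (dualops s u).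
Proof. by elim: s u => [|c s IHs] u //= Ju; apply/IHs/Ichi_Ml. Qed.

Lemma filt_dualops w s u : all ytype s -> filt w u -> filt (w - wt s) (dualops s u).
Proof.
elim: s w u => [|c s IHs] w u /=; first by rewrite /wt big_nil subr0.
by move=> /andP[yc ys] Fu; rewrite wt_cons opprD addrA; apply/IHs/filt_dualop.
Qed.

Lemma Ichi_dualop c a : ytype c -> Ichi (dualop c * a%:A).
Proof. by move=> /andP[uc cn]; apply: Ichi_xbar; rewrite inordK //. Qed.

Lemma altsgn_neq0 e s : altsgn e s != 0.
Proof. by rewrite signr_eq0. Qed.

Lemma ytype_upper s : all ytype s -> all upper s.
Proof. by apply: sub_all => c /andP[]. Qed.

(** The Leibniz rule for a derivation dual to b. The multiplicity in the last clause is carried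
    along for the induction: it shows that the constants of equal even letters add up to a nonzero
    number. *)
Lemma dualop_mon b t : ytype b -> all upper t -> sorted ltk t ->
  exists a, [/\ filt (wt t - qdeg b - 1) (dualop b * ymon t - a *: ymon (rem b t)),
    (a != 0) = (b \in t) & ~~ b.1.1 -> a = (count_mem b t)%:R].
Proof.
move=> yb; elim: t => [|d t IHt] /=.
  move=> _ _; exists 0; split=> //; last by rewrite eqxx.
  by rewrite scale0r subr0; apply: filt_J; have := Ichi_dualop 1 yb; rewrite scale1r.
move=> /andP[ud ut] dt; have [a [Fa a0 ae]] := IHt ut (path_sorted dt).
set s : K := (-1) ^+ (b.1.1 && d.1.1).
have G : filt (wt (d :: t) - qdeg b - 1) (dualop b * (ycoord d * ymon t)
    - ((s * a) *: (ycoord d * ymon (rem b t)) + kappa b d *: ymon t)).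
  have -> : dualop b * (ycoord d * ymon t)
      - ((s * a) *: (ycoord d * ymon (rem b t)) + kappa b d *: ymon t) =
    (dualop b * ycoord d - (-1) ^+ (b.1.1 && d.1.1) * (ycoord d * dualop b) - (kappa b
      d)%:A) * ymon t
      + s *: (ycoord d * (dualop b * ymon t - a *: ymon (rem b t))).
    rewrite !mulrBl mulr_algl mulrBr scalerBr -scalerAr scalerA -!mulrA /s.
    by case: (_ && _); rewrite ?expr1 ?expr0 ?scaleN1r ?scale1r; ncring.
  rewrite wt_cons; apply: filt_D.
    by apply: filt_mono (filt_dualop_ycoord yb ud (filt_mon ut)); lia.
  by apply: filt_Z; apply: filt_mono (filt_ycoord ud Fa); lia.
rewrite /= inE [b == d]eq_sym.
rewrite /kappa [b == d]eq_sym in G; have [bd|bd] := eqVneq d b; last first.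
  exists (s * a); split; first by move: G; rewrite /= (negPf bd) scale0r addr0.
    by rewrite mulf_eq0 signr_eq0.
  by move=> be; rewrite add0n ae // /s (negPf be) mul1r.
subst d; rewrite eqxx in G *.
have [bt|bt] := boolP (b \in t); last first.
  exists (altsgn b.1.1 b.1.2); split; last 1 first.
  - by move=> be; rewrite /altsgn (negPf be) (count_memPn bt).
  - have a00 : a = 0 by apply/eqP; move: a0; rewrite (negPf bt) => /negbFE.
    by rewrite a00 mulr0 scale0r add0r in G.
  - by rewrite altsgn_neq0.
(* By sortedness a second b must follow the first one directly and b is even, so both Leibniz terms
   are multiples of the same monomial. *)
have [be tE] : ~~ b.1.1 /\ t = b :: rem b t.
  case: t dt bt {IHt ut Fa a0 ae G} => //= d t /andP[bd dt]; rewrite inE.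
  case: (eqVneq b d) bd => [<- bb _|bd' bd bt]; first by move: bb; rewrite /ltk ltnn eqxx.
  have := allP (order_path_min ltk_trans dt) _ bt.
  by move=> db; case/eqP: bd'; apply: ltk_anti; rewrite bd db.
exists (a + 1); split.
- move: G; rewrite -[X in _ *: X + _]/(ymon (b :: rem b t)) -tE /s (negPf be) mul1r.
  by rewrite /altsgn expr0 -scalerDl.
- by rewrite ae // natr1 natK_eq0.
- by move=> _; rewrite ae // natrD addrC.
Qed.

(** Each operator removes one letter up to terms of smaller degree, and the remaining operators push
    those terms into negative degree. A nonzero constant survives only if the letters removed are
    exactly those of t. *)
Lemma dualops_mon s t : all ytype s -> sorted ltk s -> all upper t -> sorted ltk t ->
  wt t <= wt s ->
  exists2 a, Ichi (dualops s (ymon t) - a%:A) & (a != 0) = (t == s).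
Proof.
elim: s t => [|b s IHs] t /=.
  move=> _ _ ut _; case: t ut => [|c t] /=.
    by exists 1; rewrite ?scale1r ?subrr ?oner_eq0 ?eqxx //; apply: Ichi_0.
  by rewrite wt_cons {2}/wt big_nil => /andP[/qdeg_gt0 ? /wt_ge0 ?] ?; exfalso; lia.
move=> /andP[yb ys] bs ut st; rewrite wt_cons => ts.
have [a [Fa a0 _]] := dualop_mon yb ut st.
have Jr : Ichi (dualops s (dualop b * ymon t - a *: ymon (rem b t))).
  by apply: filt_neg (filt_dualops ys Fa); lia.
have [bt|bt] := boolP (b \in t); last first.
  exists 0; last by rewrite eqxx; apply/esym/negP => /eqP tE; rewrite tE inE eqxx in bt.
  have a00 : a = 0 by apply/eqP; move: a0; rewrite (negPf bt) => /negbFE.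
  by move: Jr; rewrite a00 !scale0r !subr0.
have pt := perm_to_rem bt.
have srt : subseq (rem b t) t by exact: rem_subseq.
have urt : all upper (rem b t).
  by apply/allP => c /(mem_subseq srt); apply: (allP ut).
have strt : sorted ltk (rem b t) by apply: (subseq_sorted _ srt st); apply: ltk_trans.
have wrt : wt (rem b t) <= wt s by move: ts; rewrite (wt_perm pt) wt_cons; lia.
have [a' Ja' a'0] := IHs _ ys (path_sorted bs) urt strt wrt.
exists (a * a').
  have -> : dualops s (dualop b * ymon t) - (a * a')%:A =
     dualops s (dualop b * ymon t - a *: ymon (rem b t)) + a *: (dualops s (ymon (rem b
       t)) - a'%:A).
    by rewrite dualopsD -[- (a *: ymon _)]scaleNr dualopsZ scaleNr scalerBr scalerA
      addrA subrK.
  by apply: Ichi_D => //; apply: Ichi_Z.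
rewrite mulf_eq0 negb_or a0 bt a'0 /=; apply/eqP/eqP => [rE|->]; last by rewrite /= eqxx.
apply: (sorted_eq ltk_trans ltk_anti) => //.
by rewrite -rE.
Qed.

End Whittaker.

(** * Whittaker vectors *)

Section Spanning.
Variables (K : fieldType) (n' : nat).
Local Notation n := n'.+1.
Variables (U : algType K) (x : bool -> 'I_n -> 'I_n -> U).

Hypothesis x_br : forall e d i j k l, scom e d (x e i j) (x d k l) =
  x (e (+) d) i l *+ (j == k) - (-1) ^+ (e && d) * x (e (+) d) k j *+ (l == i).
Hypothesis char0 : [pchar K] =i pred0.

Local Notation letter := (qletter n').
Local Notation J := (Ichi x).
Local Notation F := (filt x).
Local Notation y := (ycoord x).
Local Notation mon := (ymon x).
Local Notation xb := (xbar x).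

(** [G] stands for the image of the Yangian in [U]: a subalgebra that preserves I_chi from the right
    and realizes the last-column coordinates up to smaller degree. *)
Variable G : U -> Prop.
Hypothesis G_D : forall g h, G g -> G h -> G (g + h).
Hypothesis G_Z : forall a g, G g -> G (a *: g).
Hypothesis G_M : forall g h, G g -> G h -> G (g * h).
Hypothesis G_1 : G 1.
Hypothesis Ichi_Mr : forall g u, G g -> J u -> J (u * g).
Hypothesis G_gen : forall c : letter, upper c -> ~~ (c.2 < n')%N ->
  exists2 g, G g & F (qdeg c - 1) (y c - g).

Lemma G_0 : G 0. Proof. by rewrite -(scale0r 1); apply: G_Z. Qed.

Definition Span (u : U) := exists (L : seq (seq letter)) (w : seq letter -> U),
  [/\ uniq L, all (fun t => sorted (@ltk n') t && all (@ytype n') t) L,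
      forall t, G (w t) & J (u - \sum_(t <- L) mon t * w t)].

Lemma Span_J u : J u -> Span u.
Proof.
move=> Ju; exists [::], (fun _ => 0); split=> //; first by move=> _; apply: G_0.
by rewrite big_nil subr0.
Qed.

Lemma Span_mon t g : sorted (@ltk n') t -> all (@ytype n') t -> G g -> Span (mon t * g).
Proof.
move=> st yt Gg; exists [:: t], (fun _ => g); split=> //=; first by rewrite st yt.
by rewrite big_seq1 subrr; apply: Ichi_0.
Qed.

Lemma Span_Z a u : Span u -> Span (a *: u).
Proof.
case=> L [w [uL sL Gw Ju]]; exists L, (fun t => a *: w t); split=> //.
  by move=> t; apply: G_Z.
under eq_bigr do rewrite -scalerAr.
by rewrite -scaler_sumr -scalerBr; apply: Ichi_Z.
Qed.

Lemma sum_sub (L L' : seq (seq letter)) (f : seq letter -> U) :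
  uniq L -> uniq L' -> {subset L <= L'} ->
  \sum_(t <- L') (if t \in L then f t else 0) = \sum_(t <- L) f t.
Proof.
move=> uL uL' sLL'; rewrite -big_mkcond -big_filter; apply: perm_big.
apply: uniq_perm; rewrite ?filter_uniq // => t; rewrite mem_filter.
by case tL: (t \in L) => //=; apply: sLL'.
Qed.

Lemma Span_D u v : Span u -> Span v -> Span (u + v).
Proof.
case=> L [w [uL sL Gw Ju]] [L' [w' [uL' sL' Gw' Jv]]].
exists (undup (L ++ L')),
  (fun t => (if t \in L then w t else 0) + (if t \in L' then w' t else 0)).
split; first exact: undup_uniq.
- apply/allP => t; rewrite mem_undup mem_cat => /orP[]; last exact: (allP sL').
  exact: (allP sL).
- by move=> t; apply: G_D; case: ifP => _ //; apply: G_0.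
under eq_bigr do rewrite mulrDr !(fun_if (fun z => _ * z)) !mulr0.
rewrite big_split /= !(sum_sub (fun t => mon t * _ t)) ?undup_uniq //; last 2 first.
- by move=> t tL'; rewrite mem_undup mem_cat tL' orbT.
- by move=> t tL; rewrite mem_undup mem_cat tL.
by rewrite opprD addrACA; apply: Ichi_D.
Qed.

(** The same filtration, generated by monomials in the coordinates instead of words in the
    letters. *)
Inductive yspan (w : int) : U -> Prop :=
  | yspan_J u : J u -> yspan w u
  | yspan_D u v : yspan w u -> yspan w v -> yspan w (u + v)
  | yspan_Z a u : yspan w u -> yspan w (a *: u)
  | yspan_mon s : all (@upper n') s -> wt s <= w -> yspan w (mon s).

Lemma yspan_y w (c : letter) u : upper c -> yspan (w - qdeg c) u -> yspan w (y c * u).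
Proof.
move=> uc; elim=> {u} [u Ju|u v _ Yu _ Yv|a u _ Yu|s us ws].
- exact/yspan_J/Ichi_Ml.
- by rewrite mulrDr; apply: yspan_D.
- by rewrite -scalerAr; apply: yspan_Z.
by apply: (@yspan_mon _ (c :: s)); rewrite /= ?uc // wt_cons; lia.
Qed.

Lemma yspan_x w e (i j : 'I_n) u : (i <= j)%N -> yspan (w - ldeg i j) u -> yspan w (x e
  i j * u).
Proof.
move=> ij Yu; have uc : upper (e, i, j) by [].
(* A letter is, up to sign, the difference of two consecutive partial sums on its diagonal. *)
have xE : x e i j = altsgn K e i *: (y (e, i, j) - \sum_(s < n | (s < i)%N)
    altsgn K e s *: x e s (inord (s + (j - i)))).
  rewrite /ycoord (bigD1 i) //= -addrA [X in _ + (X - _)](_ : _ = \sum_(s < n | (s < i)%N)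
    altsgn K e s *: x e s (inord (s + (j - i)))); last first.
    by apply: eq_bigl => s; rewrite andbC -val_eqE ltn_neqAle.
  by rewrite subrr addr0 scalerA /altsgn -expr2 sqrr_sign scale1r subnKC // inord_val.
rewrite {}xE -scalerAl; apply: yspan_Z; rewrite mulrBl; apply: yspan_D; first exact:
  yspan_y.
case: (posnP i) => [i0|i0].
  by rewrite big1 ?mul0r ?oppr0 => [|s]; [apply/yspan_J/Ichi_0 | rewrite i0].
have ? := ltn_ord j; have ? := ltn_ord i.
have uc' : upper (e, inord i.-1, inord j.-1 : 'I_n).
  by rewrite /upper /= !inordK; lia.
rewrite -scaleN1r; apply: yspan_Z.
rewrite (_ : \sum_(s < n | _) _ = y (e, inord i.-1, inord j.-1)).
  by apply: yspan_y => //; rewrite /qdeg /= /ldeg !inordK in Yu *; try lia;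
    congr (yspan (w - _) u): Yu; lia.
rewrite /ycoord /=; apply: eq_big => s; first by rewrite inordK; lia.
by move=> _; congr (_ *: x e s (inord (s + _))); rewrite !inordK; lia.
Qed.

Lemma filt_yspan w u : F w u -> yspan w u.
Proof.
elim=> {w u} [w u Ju|w w0|w u v _ Yu _ Yv|w a u _ Yu|w e i j u ij _ Yu].
- exact: yspan_J.
- by apply: (@yspan_mon _ [::]); rewrite // /wt big_nil.
- exact: yspan_D.
- exact: yspan_Z.
exact: yspan_x.
Qed.

Lemma digits_leq (m a b e a' b' e' : nat) : (b' < m)%N -> (e' <= 1)%N ->
  ((a * m + b) * 2 + e <= (a' * m + b') * 2 + e')%N -> (a <= a')%N.
Proof.
move=> b'm e'1 le_ab; rewrite leqNgt; apply/negP => a'a.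
have : (a'.+1 * m <= a * m)%N by rewrite leq_mul2r a'a orbT.
by rewrite mulSn; move: le_ab; move: (a * m)%N (a' * m)%N => p q; lia.
Qed.

(* Sorting a monomial costs terms of smaller degree; a final letter of the last
   column is then exchanged for an element of G. *)
Lemma filt_Span w u g : F w u -> G g -> Span (u * g).
Proof.
(* The shift by one lets the induction start in degree -1, where everything lies in I_chi. *)
suff H (N : nat) v h : F (N%:Z - 1) v -> G h -> Span (v * h).
  by move=> Fu; apply: (H (absz (w + 1))) => //; apply: filt_mono Fu; lia.
elim: N v h => [|N IHN] v h; first by move=> Fv Gh; apply/Span_J/Ichi_Mr/(filt_neg _ Fv).
move=> /filt_yspan Yv Gh; elim: Yv => {v} [v Jv|v v' _ Sv _ Sv'|a v _ Sv|s us ws].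
- exact/Span_J/Ichi_Mr.
- by rewrite mulrDl; apply: Span_D.
- by rewrite -scalerAl; apply: Span_Z.
have IH v h' : F (N%:Z - 1) v -> G h' -> Span (v * h') by exact: IHN.
case: (mon_sort x_br char0 us) => [Fs|[a [t [st pt Fs]]]].
  by apply: IH => //; apply: filt_mono Fs; lia.
rewrite -[mon s](subrK (a *: mon t)) mulrDl; apply: Span_D.
  by apply: IH => //; apply: filt_mono Fs; lia.
rewrite -scalerAl; apply: Span_Z.
have ut : all (@upper n') t by rewrite (perm_all _ pt).
have {ws} wt' : wt t <= N%:Z by rewrite (wt_perm pt); lia.
case: (lastP t) st ut wt' => [|t' c] st ut wt'; first exact: Span_mon.
(* Keys compare columns first: if the last letter is outside the last column, so are all the
   others. *)
have [cn|cn] := boolP (c.2 < n')%N.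
  apply: Span_mon => //; apply/allP => d dt; rewrite /ytype (allP ut) //=.
  apply: leq_ltn_trans cn.
  have : (qkey d <= qkey c)%N.
    move: dt; rewrite mem_rcons inE => /orP[/eqP->//|dt'].
    apply: ltk_qkey; move: st; rewrite -cats1.
    rewrite (sorted_pairwise (@ltk_trans n')) pairwise_cat => /andP[/allrelP tc _].
    by apply: tc => //; rewrite inE.
  rewrite /qkey => le_key; apply: (digits_leq (ltn_ord c.1.2) (leq_b1 c.1.1) le_key).
move: ut wt'; rewrite all_rcons => /andP[uc ut'].
rewrite (wt_perm (permEl (perm_rcons c t'))) wt_cons => wt'.
have [g' Gg' Fg'] := G_gen uc cn.
have dc := qdeg_gt0 uc.
have Ft' := filt_mon x_br ut'.
(* With y c = (y c - g') + g', the first part has smaller degree; in the second the monomial has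
   lost a letter of positive degree and g' joins the coefficient. *)
rewrite -cats1 mon_cat /= mulr1 -[y c](subrK g') mulrDr mulrDl -[_ * g' * h]mulrA.
apply: Span_D; apply: IH => //; last exact: G_M.
  by apply: filt_mono (filt_monl x_br ut' Fg'); lia.
by apply: filt_mono Ft'; lia.
Qed.

(* The dual operators of a monomial of maximal degree kill v but extract the
   coefficient of that monomial, which therefore vanishes modulo I_chi.  This
   replaces the linear independence given by the PBW theorem. *)
Theorem whittaker_vectors w v : F w v ->
  (forall e (i j : 'I_n), (j < i)%N -> J (xb e i j * v)) ->
  exists2 g, G g & J (v - g).
Proof.
move=> /filt_Span/(_ G_1); rewrite mulr1 => -[L [f [uL sL Gf Jv]]] Wv.
have [m sizeL] := ubnP (size L); elim: m L sizeL uL sL Jv => // m IHm L sizeL uL sL Jv.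
case: (eqVneq L [::]) => [L0|L0].
  by exists 0; [apply: G_0 | move: Jv; rewrite L0 big_nil].
have [s sL' smax] : exists2 s, s \in L & forall t, t \in L -> wt t <= wt s.
  case: L L0 {sizeL uL sL Jv} => // a L _; elim: L a => [|b L IHL] a.
    by exists a; rewrite ?inE // => t; rewrite inE => /eqP->.
  have [s sL' smax] := IHL b; have [as_|sa] := leP (wt a) (wt s).
    by exists s => [|t]; rewrite inE ?sL' ?orbT // => /orP[/eqP->//|]; apply: smax.
  exists a => [|t]; rewrite inE ?eqxx // => /orP[/eqP->//|/smax ts].
  exact: le_trans ts (ltW sa).
have /andP[ss ys] := allP sL _ sL'.
have tail : J (f s) -> exists2 g, G g & J (v - g).
  move=> Js; apply: (IHm (rem s L)); rewrite ?rem_uniq ?size_rem //.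
  - by move: sizeL; case: (L) L0 => //= *; lia.
  - by apply/allP => t /mem_rem; apply: (allP sL).
  move: Jv; rewrite (perm_big _ (perm_to_rem sL')) big_cons /= opprD addrCA.
  move=> Jv; rewrite -[v - _](addKr (- (mon s * f s))); apply: Ichi_D => //.
  by rewrite opprK; apply: Ichi_Ml.
(* If the empty monomial has maximal degree, it is the only one, and v is congruent to its
   coefficient. *)
have key_eq : (s = [::] -> L = [:: s]).
  move=> s0; have all0 t : t \in L -> t = s.
    move=> tL; have := smax t tL; rewrite s0 /wt big_nil.
    have /andP[_ /ytype_upper] := allP sL _ tL.
    case: t {tL} => // c t /= /andP[/qdeg_gt0 ? /wt_ge0 +].
    by rewrite -/(wt _) wt_cons => ? ?; exfalso; lia.
  case: L uL all0 sL' {sizeL sL L0 Jv smax tail} => // a [|b L] uL all0 _.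
    by rewrite (all0 a) ?inE.
  have ea := all0 a (mem_head _ _); have eb : b = s by apply: all0; rewrite !inE eqxx orbT.
  by move: uL; rewrite ea eb /= inE eqxx.
case: (eqVneq s [::]) => [s0|s0].
  exists (f s) => //; move: Jv; rewrite (key_eq s0) big_seq1 s0 /=.
  by rewrite mul1r.
(* As s is nonempty, at least one dual operator hits v, which is a Whittaker vector. *)
have Jops : J (dualops x s v).
  case: s s0 ys {ss sL' smax tail key_eq} => // c s _ /= /andP[yc ys].
  apply/Ichi_dualops/Wv; move: yc; rewrite /ytype /upper => /andP[? ?].
  by rewrite inordK //.
apply: tail.
have ops_t t : t \in L -> exists2 a, J (dualops x s (mon t * f t) - a *: f t) & (a !=
  0) = (t == s).
  move=> tL; have /andP[st yt] := allP sL _ tL.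
  have [a Ja a0] := dualops_mon x_br char0 ys ss (ytype_upper yt) st (smax t tL).
  by exists a => //; rewrite dualopsMr -mulr_algl -mulrBl; apply: Ichi_Mr.
have : J (dualops x s (v - \sum_(t <- L) mon t * f t)) by exact: Ichi_dualops.
rewrite -scaleN1r dualopsD dualopsZ scaleN1r dualops_sum => Jd.
have {Jd} Jsum : J (\sum_(t <- L) dualops x s (mon t * f t)).
  by rewrite -[X in J X](subKr (dualops x s v)); apply: Ichi_B.
move: Jsum; rewrite (perm_big _ (perm_to_rem sL')) big_cons /= => Jsum.
have [a Ja] := ops_t s sL'; rewrite eqxx => a0.
have Jrest : J (\sum_(t <- rem s L) dualops x s (mon t * f t)).
  rewrite big_seq; apply: big_ind => [|u u'|t]; [exact: Ichi_0|exact: Ichi_D|].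
  rewrite mem_rem_uniq // !inE => /andP[ts tL].
  have [a' Ja'] := ops_t t tL; rewrite (negPf ts) => /negbFE/eqP a'0.
  by move: Ja'; rewrite a'0 scale0r subr0.
have : J (a *: f s).
  rewrite -[a *: _](subKr (dualops x s (mon s * f s))); apply: Ichi_B => //.
  by move: (Ichi_B Jsum Jrest); rewrite addrK.
by move=> /(Ichi_Z a^-1); rewrite scalerA mulVf // scale1r.
Qed.

End Spanning.

(** * Leading terms *)

Section Leading.
Variables (K : fieldType) (n' : nat).
Local Notation n := n'.+1.
Variables (U : algType K) (x : bool -> 'I_n -> 'I_n -> U).

Hypothesis x_br : forall e d i j k l, scom e d (x e i j) (x d k l) =
  x (e (+) d) i l *+ (j == k) - (-1) ^+ (e && d) * x (e (+) d) k j *+ (l == i).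

Local Notation J := (Ichi x).
Local Notation F := (filt x).
Local Notation y := (ycoord x).
Local Notation xb := (xbar x).
Local Notation Q := (gpow x).

(** The minus sign in the recursion of [gpow] times the sign of row h in [gmx]. *)
Definition sgnc (h : bool) : K := (-1) ^+ ~~ h.

(* A path of length m from row a to column 0 reaches the leading degree of [gpow]
   only if it descends by unit steps, on which chi is 1, except for one step
   b -> m' with b <= m' that contributes [jump]. *)
Definition jump (h g : bool) (m a : nat) : U :=
  if (a <= m < n)%N then (sgnc h * sgnc g ^+ m) *: x (h (+) g) (inord a) (inord m) else 0.

Fixpoint lead (h g : bool) (m a : nat) : U :=
  match a, m with
  | 0, 0 => (h == g)%:R
  | 0, m'.+1 => jump h g m' 0
  | _.+1, 0 => 0
  | a'.+1, m'.+1 => sgnc h *: lead h g m' a' + jump h g m' a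
  end.

Lemma lead_gt h g m a : (m < a)%N -> lead h g m a = 0.
Proof.
elim: a m => [|a IHa] [|m] //= ma.
by rewrite IHa // /jump; case: ifP => [?|_]; [lia | rewrite scaler0 addr0].
Qed.

Lemma lead_eq h g a : lead h g a a = ((h == g)%:R * sgnc g ^+ a)%:A.
Proof.
elim: a => [|a IHa] /=; first by rewrite mulr1 scaler_nat.
rewrite IHa /jump ltnn addr0 scalerA exprS mulrCA.
by case: eqP => [->|_]; rewrite ?mul0r.
Qed.

Lemma lead_F h g m a : (a < m)%N -> F ((m%:Z - a%:Z) * 2 - 1) (lead h g m a).
Proof.
have jumpF b l : F ((l%:Z - b%:Z) * 2 + 1) (jump h g l b).
  rewrite /jump; case: ifP => [/andP[bl ln]|_]; last exact: filt_0.
  apply: filt_Z; rewrite -[x _ _ _]mulr1; apply: filt_x.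
    by rewrite !inordK ?(leq_ltn_trans bl).
  by apply: filt_1; rewrite /ldeg !inordK ?(leq_ltn_trans bl) //; lia.
elim: a m => [|a IHa] [|m] //= am; first by apply: filt_mono (jumpF _ _); lia.
apply: filt_D; last by apply: filt_mono (jumpF _ _); lia.
by apply: filt_Z; apply: filt_mono (IHa _ am); lia.
Qed.

Lemma filt_DB w (u v u' v' : U) : F w (u - u') -> F w (v - v') -> F w (u + v - (u' + v')).
Proof. by move=> ? ?; rewrite [- (u' + v')]opprD addrACA; apply: filt_D. Qed.

Lemma filt_lead m g h (a : 'I_n) :
  F ((m%:Z - a%:Z) * 2 - 2) (Q m (g, ord0) (h, a) - lead h g m a).
Proof.
elim: m h a => [|m IHm] h a.
  rewrite /= xpair_eqE [g == h]eq_sym -[ord0 == a]val_eqE /=.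
  case: (a : nat) => [|a'] /=; first by rewrite andbT [X in F _ X]subrr; apply: filt_0.
  by rewrite [_ && _]andbF [X in F _ X]subr0; apply: filt_0.
(* Splitting x into its shifted part and its character separates jumps from unit descents. *)
have -> : Q m.+1 (g, ord0) (h, a) = sgnc h *:
    (\sum_(p : bool * 'I_n) xb (h (+) p.1) a p.2 * Q m (g, ord0) p
     + \sum_(p : bool * 'I_n) chiv K (h (+) p.1) a p.2 *: Q m (g, ord0) p).
  rewrite gpowS -big_split /= scaler_sumr -sumrN; apply: eq_bigr => p _.
  rewrite /gmx /= -[chiv _ _ _ _ *: _]mulr_algl -mulrDl xbarE subrK /sgnc.
  by case: h; rewrite /= ?expr0 ?expr1 ?scaleN1r ?scale1r ?mulN1r ?mul1r ?mulNr ?opprK.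
have chr_sum : \sum_(p : bool * 'I_n) chiv K (h (+) p.1) a p.2 *: Q m (g, ord0) p =
    if (a : nat) is a'.+1 then Q m (g, ord0) (h, inord a') else 0.
  case Ea: (a : nat) => [|a'].
    by rewrite big1 // => p _; rewrite /chiv Ea andbF scale0r.
  have a'n : (a' < n)%N by have := ltn_ord a; rewrite Ea => /ltnW.
  rewrite (bigD1 (h, inord a')) //= /chiv addbb Ea inordK // eqxx scale1r.
  rewrite big1 ?addr0 // => -[b c]; rewrite xpair_eqE /= => /negPf hbc.
  have -> : ~~ (h (+) b) && (a'.+1 == c.+1) = false; last by rewrite scale0r.
  rewrite eqSS -[RHS]hbc -val_eqE /= inordK // [a' == c]eq_sym.
  by congr (_ && _); case: (h); case: (b).
(* After a jump to column c, leading degree is reached only if the rest of the path is a scalar,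
   which forces c = m. *)
have term p : F ((m%:Z - a%:Z) * 2) (xb (h (+) p.1) a p.2 * Q m (g, ord0) p
    - (if (p == (g, inord m)) && (a <= m < n)%N
       then sgnc g ^+ m *: x (h (+) g) a (inord m) else 0)).
  case: p => b c /=; rewrite -[Q m _ _](subrK (lead b g m c)) [xb _ _ _ * _]mulrDr -[X
    in F _ X]addrA.
  apply: filt_D; first by apply: filt_mono (filt_xbar x_br _ _ _ (IHm b c)); rewrite
    /ldeg; lia.
  have [cm|mc|cm] := ltngtP c m.
  - apply: filt_B; first by apply: filt_mono (filt_xbar x_br _ _ _ (lead_F b g cm));
    rewrite /ldeg; lia.
    case: ifP => [/andP[/eqP[_ cE] /andP[_ mn]]|_]; last exact: filt_0.
    by move: cm; rewrite cE inordK // ltnn.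
  - rewrite lead_gt // mulr0 sub0r; apply: filt_N.
    case: ifP => [/andP[/eqP[_ cE] /andP[_ mn]]|_]; last exact: filt_0.
    by move: mc; rewrite cE inordK // ltnn.
  have mn : (m < n)%N by rewrite -cm.
  rewrite -cm lead_eq inord_val xpair_eqE eqxx andbT ltn_ord andbT.
  case: (eqVneq b g) => [->|_]; last by rewrite mul0r scale0r mulr0 subr0; apply: filt_0.
  have [ac|ca] := leqP a c.
    by rewrite /= xbar_upper // mul1r mulr_algr subrr; apply: filt_0.
  by rewrite subr0; apply/filt_J/Ichi_xbar.
have jumpE : \sum_(p : bool * 'I_n) (if (p == (g, inord m)) && (a <= m < n)%N
       then sgnc g ^+ m *: x (h (+) g) a (inord m) else 0) = sgnc h *: jump h g m a.
  rewrite -big_mkcond /= /jump; case: ifP => amn.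
    under eq_bigl do rewrite andbT.
    by rewrite big_pred1_eq scalerA mulrA -expr2 sqrr_sign mul1r inord_val.
  by rewrite big1 ?scaler0 // => p; rewrite andbF.
have -> : lead h g m.+1 a = sgnc h *: (sgnc h *: jump h g m a
    + if (a : nat) is a'.+1 then lead h g m a' else 0).
  rewrite scalerDr scalerA -expr2 sqrr_sign scale1r.
  by case: (a : nat) => [|a'] /=; rewrite ?scaler0 ?addr0 // addrC.
rewrite -scalerBr; apply: filt_Z; apply: filt_DB.
  rewrite -jumpE -sumrB; apply: filt_sum => p _.
  by apply: filt_mono (term p); lia.
rewrite chr_sum; case Ea: (a : nat) => [|a']; first by rewrite subrr; apply: filt_0.
have a'n : (a' < n)%N by have := ltn_ord a; rewrite Ea => /ltnW.
by have := IHm h (inord a'); rewrite inordK //; apply: filt_mono; lia.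
Qed.

Lemma lead_lt h g k a : (a < n)%N ->
  lead h g (a + k.+1) a = (sgnc h ^+ a.+1 * sgnc g ^+ k) *:
    \sum_(s < n | (s <= a)%N && (s + k < n)%N)
      altsgn K (h (+) g) s *: x (h (+) g) s (inord (s + k)).
Proof.
elim: a => [_|a IHa an].
  rewrite add0n /= /jump leq0n /= expr1; case: ifP => kn; last first.
    rewrite big1 ?scaler0 // => s; rewrite leqn0 => /andP[/eqP->].
    by rewrite add0n kn.
  congr (_ *: _); rewrite (big_pred1 ord0) => [|s]; last first.
    rewrite leqn0 -[RHS]val_eqE /=; case: eqP => //= ->.
    by rewrite add0n kn.
  by rewrite /altsgn andbF scale1r add0n; congr x; apply: val_inj; rewrite /= inordK.
rewrite addSn /= IHa ?(ltnW an) // [in RHS](bigID (fun s : 'I_n => (s <= a)%N)) /=.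
rewrite scalerDr; congr (_ + _).
  rewrite scalerA mulrA -exprS; congr (_ *: _); apply: eq_bigl => s.
  by case: (leqP s a) => [sa|]; rewrite ?andbT ?andbF // (leqW sa).
rewrite /jump; case: ifP => [/andP[_ akn]|ak]; last first.
  rewrite big1 ?scaler0 // => s /andP[/andP[sa sk]]; rewrite -ltnNge => as_.
  have sE : s = a.+1 :> nat by apply/eqP; rewrite eqn_leq sa as_.
  by move: ak; rewrite -addSnnS leq_addr -sE sk.
rewrite (big_pred1 (inord a.+1)) => [|s]; last first.
  rewrite -[RHS]val_eqE /= inordK // -ltnNge.
  case: eqP => [->|]; first by rewrite addSnnS akn ?leqnn ?ltnSn.
  by case: (leqP s a.+1) => //= *; lia.
rewrite inordK // scalerA addSnnS; congr (_ *: _).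
have signX (b : bool) m : ((-1) ^+ b) ^+ m = (-1) ^+ (b && odd m) :> K.
  by case: b; rewrite ?expr1n // signr_odd.
rewrite /altsgn /sgnc !signX -!signr_addb oddD /= !negbK; congr (_ ^+ _).
by case: (h); case: (g); case: (odd a); case: (odd k).
Qed.

(** In the bottom row the sum of [lead_lt] is cut off by the column bound s + k < n alone. For k =
    n' - i this reads s <= i, which is the partial sum defining the coordinate in row i of the last
    column. *)
Lemma y_lead (c : qletter n') : upper c -> ~~ (c.2 < n')%N ->
  exists2 a, a != 0 &
    F (qdeg c - 1) (y c - a *: Q (n + (n' - c.1.2)) (c.1.1, ord0) (false, ord_max)).
Proof.
case: c => [[e i] j]; rewrite /upper /= => ij jn.
have ijn : (i <= n')%N by rewrite -ltnS ltn_ord.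
have jE : j = ord_max.
  by apply: val_inj => /=; have := ltn_ord j; lia.
rewrite jE.
suff [a a0 Fa] : exists2 a, a != 0 & F (qdeg (e, i, ord_max) - 1)
    (y (e, i, ord_max) - a *: Q (n + (n' - i)) (e, ord0) (false, ord_max)).
  by exists a.
have := filt_lead (n + (n' - i)) e false ord_max.
rewrite addSnnS lead_lt //; set q := Q _ _ _; rewrite /ycoord /=.
set s : K := sgnc false ^+ n * sgnc e ^+ (n' - i); move=> Fs.
have s0 : s != 0 by rewrite mulf_neq0 // expf_neq0 // signr_eq0.
exists s^-1; first by rewrite invr_eq0.
have -> : \sum_(t < n | (t <= i)%N) altsgn K e t *: x e t (inord (t + (n' - i))) =
   s^-1 *: (s *: \sum_(t < n | (t <= n')%N && (t + (n' - i) < n)%N)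
     altsgn K e t *: x e t (inord (t + (n' - i)))).
  rewrite scalerA mulVf // scale1r.
  by apply: eq_bigl => t; have := ltn_ord t; lia.
rewrite -scalerBr; apply: filt_Z; rewrite -[X in F _ X]opprB; apply: filt_N; apply:
  filt_mono Fs.
by rewrite /qdeg /= /ldeg; lia.
Qed.

(** At exponent n' the error of [filt_lead] in the bottom row has degree -2. This gives T^{(0)} =
    delta after the shift. *)
Lemma gpow_norm g h : J (Q n' (g, ord0) (h, ord_max) - ((h == g)%:R * sgnc g ^+ n')%:A).
Proof.
rewrite -lead_eq; have := filt_lead n' g h ord_max.
by apply: filt_neg => /=; lia.
Qed.

Lemma gpow_com e (i j : 'I_n) g h m : (j < i)%N ->
  x e i j * Q m (g, ord0) (h, ord_max) =
  (-1) ^+ (e && (g (+) h)) * (Q m (g, ord0) (h, ord_max) * x e i j).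
Proof.
move=> ij; have := scom_x_gpow x_br m e i j (g, ord0) (h, ord_max) => /=.
have -> : j == ord_max = false.
  by apply/eqP => jE; move: ij; rewrite jE ltnNge -ltnS ltn_ord.
have -> : ord0 == i = false by apply/eqP => iE; move: ij; rewrite -iE ltn0.
by rewrite !mulr0n subr0 /scom => /eqP; rewrite subr_eq0 => /eqP.
Qed.

Lemma Ichi_gpow_Mr u g h m : J u -> J (u * Q m (g, ord0) (h, ord_max)).
Proof.
elim=> [|u1 u2 _ J1 _ J2|u1 e i j ij]; first by rewrite mul0r; apply: Ichi_0.
  by rewrite mulrDl; apply: Ichi_D.
rewrite -mulrA; apply: Ichi_Ml.
have -> : xb e i j * Q m (g, ord0) (h, ord_max) =
    ((-1) ^+ (e && (g (+) h)) * Q m (g, ord0) (h, ord_max)) * xb e i j.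
  rewrite xbarE mulrBl gpow_com // mulrBr mulr_algl mulr_algr mulrA; congr (_ - _).
  by case: e; rewrite /chiv /= ?scale0r // mul1r.
exact: Ichi_gen.
Qed.

End Leading.

HB.instance Definition _ (K : fieldType) (X : Type) := gen_eqMixin (term K X).
HB.instance Definition _ (K : fieldType) (X : Type) := gen_choiceMixin (term K X).

(** * The enveloping algebra of Q(n) as a ring *)

Section Enveloping.
Variables (K : fieldType) (n : nat).
Local Notation T := (term K (QB n)).

Definition ueqb (a b : T) : bool := `[< ueq a b >].

Lemma ueqb_refl : reflexive ueqb.
Proof. by move=> a; apply/asboolP/ce_refl. Qed.

Lemma ueqb_sym : symmetric ueqb.
Proof. by move=> a b; apply/asboolP/asboolP; apply: ce_sym. Qed.

Lemma ueqb_trans : transitive ueqb.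
Proof. by move=> b a c /asboolP ab /asboolP bc; apply/asboolP/ce_trans/bc. Qed.

Canonical ueqb_equiv := EquivRel ueqb ueqb_refl ueqb_sym ueqb_trans.

Definition envQ := {eq_quot ueqb}%qT.

HB.instance Definition _ := Choice.on envQ.

Definition cl (t : T) : envQ := \pi_envQ%qT t.

Lemma clP a b : cl a = cl b <-> ueq a b.
Proof.
split=> [/eqmodP/asboolP//|ab]; apply/eqmodP; exact/asboolP.
Qed.

Lemma cl_repr (u : envQ) : cl (repr u) = u.
Proof. exact: reprK. Qed.

Lemma ueq_repr t : ueq (repr (cl t)) t.
Proof. by apply/clP; rewrite cl_repr. Qed.

Lemma cl_ind (Pr : envQ -> Prop) : (forall t, Pr (cl t)) -> forall u, Pr u.
Proof. by move=> Pt u; rewrite -(cl_repr u). Qed.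

Definition eadd (u v : envQ) := cl (Tadd (repr u) (repr v)).
Definition eopp (u : envQ) := cl (tneg (repr u)).
Definition emul (u v : envQ) := cl (Tmul (repr u) (repr v)).
Definition escale (a : K) (u : envQ) := cl (tscale a (repr u)).

Lemma cl_add a b : cl (Tadd a b) = eadd (cl a) (cl b).
Proof. by apply/clP/ce_sym/ce_add; apply: ueq_repr. Qed.

Lemma cl_mul a b : cl (Tmul a b) = emul (cl a) (cl b).
Proof. by apply/clP/ce_sym/ce_mul; apply: ueq_repr. Qed.

Lemma cl_scale c a : cl (tscale c a) = escale c (cl a).
Proof. by apply/clP/ce_sym/ce_mul; [apply: ce_refl | apply: ueq_repr]. Qed.

Lemma cl_neg a : cl (tneg a) = eopp (cl a).
Proof. by apply/clP/ce_sym/ce_mul; [apply: ce_refl | apply: ueq_repr]. Qed.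

Lemma eaddA : associative eadd.
Proof.
elim/cl_ind => a; elim/cl_ind => b; elim/cl_ind => c.
by rewrite -!cl_add; apply/clP/ce_sym/ce_addA.
Qed.

Lemma eaddC : commutative eadd.
Proof. by elim/cl_ind => a; elim/cl_ind => b; rewrite -!cl_add; apply/clP/ce_addC. Qed.

Lemma eadd0 : left_id (cl (Tc 0)) eadd.
Proof. by elim/cl_ind => a; rewrite eaddC -cl_add; apply/clP/ce_add0. Qed.

Lemma eaddN : left_inverse (cl (Tc 0)) eopp eadd.
Proof. by elim/cl_ind => a; rewrite -cl_neg eaddC -cl_add; apply/clP/ce_addN. Qed.

HB.instance Definition _ := GRing.isZmodule.Build envQ eaddA eaddC eadd0 eaddN.

Lemma emulA : associative emul.
Proof.
elim/cl_ind => a; elim/cl_ind => b; elim/cl_ind => c.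
by rewrite -!cl_mul; apply/clP/ce_sym/ce_mulA.
Qed.

Lemma emul1l : left_id (cl (Tc 1)) emul.
Proof. by elim/cl_ind => a; rewrite -cl_mul; apply/clP/ce_mul1l. Qed.

Lemma emul1r : right_id (cl (Tc 1)) emul.
Proof. by elim/cl_ind => a; rewrite -cl_mul; apply/clP/ce_mul1r. Qed.

Lemma emulDl : left_distributive emul +%R.
Proof.
elim/cl_ind => a; elim/cl_ind => b; elim/cl_ind => c.
by rewrite /GRing.add /= -!(cl_add, cl_mul); apply/clP/ce_mulDl.
Qed.

Lemma emulDr : right_distributive emul +%R.
Proof.
elim/cl_ind => a; elim/cl_ind => b; elim/cl_ind => c.
by rewrite /GRing.add /= -!(cl_add, cl_mul); apply/clP/ce_mulDr.
Qed.

(** The counit. Brackets have no constant term, so it respects the relations, and it separates 1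
    from 0. *)
Fixpoint augment (t : T) : K :=
  match t with
  | Tg _ => 0
  | Tc c => c
  | Tadd a b => augment a + augment b
  | Tmul a b => augment a * augment b
  end.

Lemma augment_ueq a b : ueq a b -> augment a = augment b.
Proof.
elim=> {a b} //=.
- move=> a b [[[e i] j] [[d k] l]] /=.
  by rewrite !mulr0 !addr0.
- by move=> a b c _ -> _ ->.
- by move=> a a' b b' _ -> _ ->.
- by move=> a a' b b' _ -> _ ->.
- by move=> a b c; rewrite addrA.
- by move=> a b; rewrite addrC.
- by move=> a; rewrite addr0.
- by move=> a; rewrite mulN1r subrr.
- by move=> a b c; rewrite mulrA.
- by move=> a; rewrite mul1r.
- by move=> a; rewrite mulr1.
- by move=> a b c; rewrite mulrDl.
- by move=> a b c; rewrite mulrDr.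
- by move=> a b; rewrite mulrC.
Qed.

Lemma e1_neq0 : cl (Tc 1) != 0.
Proof.
apply/eqP => /clP/augment_ueq /= /eqP.
by rewrite oner_eq0.
Qed.

HB.instance Definition _ := GRing.Zmodule_isNzRing.Build envQ
  emulA emul1l emul1r emulDl emulDr e1_neq0.

Lemma escaleA a b u : escale a (escale b u) = escale (a * b) u.
Proof.
elim/cl_ind: u => t; rewrite -!cl_scale; apply/clP.
apply: ce_trans (ce_sym (ce_mulA _ _ _ _)) _; apply: ce_mul (ce_refl _ _).
exact: ce_cmul.
Qed.

Lemma escale1 : left_id 1 escale.
Proof. by elim/cl_ind => t; rewrite -cl_scale; apply/clP/ce_mul1l. Qed.

Lemma escaleDr : right_distributive escale +%R.
Proof.
move=> c; elim/cl_ind => a; elim/cl_ind => b.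
by rewrite /GRing.add /= -!(cl_add, cl_scale); apply/clP/ce_mulDr.
Qed.

Lemma escaleDl u : {morph escale^~ u : a b / a + b}.
Proof.
move=> a b; elim/cl_ind: u => t.
rewrite [RHS]/GRing.add /= -!cl_scale -cl_add; apply/clP.
apply: ce_trans (ce_mulDl _ _ _ _); apply: ce_mul (ce_refl _ _).
exact/ce_sym/ce_cadd.
Qed.

HB.instance Definition _ := GRing.Zmodule_isLmodule.Build K envQ
  escaleA escale1 escaleDr escaleDl.

Lemma escaleAl (a : K) (u v : envQ) : a *: (u * v) = (a *: u) * v.
Proof.
elim/cl_ind: u => s; elim/cl_ind: v => t.
rewrite /GRing.scale /GRing.mul /= -!(cl_mul, cl_scale); apply/clP/ce_sym/ce_mulA.
Qed.

HB.instance Definition _ := GRing.Lmodule_isLalgebra.Build K envQ escaleAl.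

Lemma escaleAr (a : K) (u v : envQ) : a *: (u * v) = u * (a *: v).
Proof.
elim/cl_ind: u => s; elim/cl_ind: v => t.
rewrite /GRing.scale /GRing.mul /= -!(cl_mul, cl_scale); apply/clP.
apply: ce_trans (ce_sym (ce_mulA _ _ _ _)) _.
apply: ce_trans _ (ce_mulA _ _ _ _); apply: ce_mul (ce_refl _ _).
exact: ce_ccomm.
Qed.

HB.instance Definition _ := GRing.Lalgebra_isAlgebra.Build K envQ escaleAr.

Lemma clD a b : cl (Tadd a b) = cl a + cl b. Proof. exact: cl_add. Qed.

Lemma clM a b : cl (Tmul a b) = cl a * cl b. Proof. exact: cl_mul. Qed.

Lemma clZ c a : cl (tscale c a) = c *: cl a. Proof. exact: cl_scale. Qed.

Lemma clN a : cl (tneg a) = - cl a. Proof. exact: cl_neg. Qed.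

Lemma clB a b : cl (tsub a b) = cl a - cl b. Proof. by rewrite clD clN. Qed.

Lemma clC c : cl (Tc c) = c%:A.
Proof. by rewrite -clZ; apply/clP/ce_sym/ce_mul1r. Qed.

Lemma cl_tsum s : cl (tsum s) = \sum_(t <- s) cl t.
Proof. by elim: s => [|t s IHs]; rewrite ?big_nil ?big_cons //= clD IHs. Qed.

End Enveloping.

Lemma scale_sign (K : fieldType) (U : algType K) (b : bool) (u : U) :
  (-1 : K) ^+ b *: u = (-1) ^+ b * u.
Proof. by case: b; rewrite ?expr0 ?expr1 ?scale1r ?mul1r ?scaleN1r ?mulN1r. Qed.

(** * The homomorphism *)

Section Hom.
Variables (K : fieldType) (n' : nat).
Local Notation n := n'.+1.
Local Notation U := (envQ K n).
Local Notation T := (term K (QB n)).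

Definition xq (e : bool) (i j : 'I_n) : U := cl (qgen K e i j).

Lemma xq_br e d i j k l : scom e d (xq e i j) (xq d k l) =
  xq (e (+) d) i l *+ (j == k) - (-1) ^+ (e && d) * xq (e (+) d) k j *+ (l == i).
Proof.
have /clP := ce_rel (ru_br K (e, i, j) (d, k, l)).
rewrite clB clZ !clM clD !clZ -!/(xq _ _ _) scale_sign /scom => ->.
rewrite -scaler_nat -scaler_nat.
by case: (e && d); rewrite ?mul1r ?mulN1r ?expr1 ?expr0 ?mul1r ?mulN1r ?scaleNr
  ?scalerN ?opprK.
Qed.

Local Notation J := (Ichi xq).
Local Notation F := (filt xq).
Local Notation Q := (gpow xq).
Local Notation xb := (xbar xq).

(** * Comparison of the two descriptions of I_chi and of Whittaker vectors *)

Lemma chi0E (b : QB n) : chi0 K b = chiv K b.1.1 b.1.2 b.2.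
Proof. by rewrite /chi0 /chiv; case: (_ && _). Qed.

Lemma Ichi_sum I (r : seq I) (f : I -> U) : (forall i, J (f i)) -> J (\sum_(i <- r) f i).
Proof. by move=> Jf; apply: big_ind => //; [apply: Ichi_0 | apply: Ichi_D]. Qed.

Lemma cl_sumQB (f : QB n -> T) :
  cl (tsum [seq f b | b <- enum [set: bool * 'I_n * 'I_n]]) = \sum_b cl (f b).
Proof. by rewrite cl_tsum big_map big_enum; apply: eq_bigl => b; rewrite inE. Qed.

Lemma inI_J t : inI (K := K) (n := n) t -> J (cl t).
Proof.
elim=> {t} [|a b _ Ja _ Jb|u c mc|a b _ Ja /clP <- //].
- by rewrite clC scale0r; apply: Ichi_0.
- by rewrite clD; apply: Ichi_D.
rewrite clM clB clC cl_sumQB /chi scaler_suml -sumrB mulr_sumr.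
apply: Ichi_sum => -[[e i] j].
have [ij|ij] := boolP (lowerQ (e, i, j)); last first.
  by rewrite clZ mc // mul0r !scale0r subrr mulr0; apply: Ichi_0.
rewrite clZ -scalerA -scalerBr -scalerAr chi0E -[cl (Tg (e, i, j))]/(xq e i j) -xbarE.
exact/Ichi_Z/Ichi_gen.
Qed.

Definition dlt (b : QB n) : {ffun QB n -> K} := [ffun b' => (b' == b)%:R].

Lemma dlt_m b : lowerQ b -> in_m (dlt b).
Proof. by move=> lb b'; rewrite ffunE; case: eqP => // ->; rewrite lb. Qed.

Lemma sum_dlt (V : lmodType K) b (f : QB n -> V) : \sum_b' dlt b b' *: f b' = f b.
Proof.
rewrite (bigD1 b) //= ffunE eqxx scale1r big1 ?addr0 // => b' /negPf.
by rewrite ffunE => ->; rewrite scale0r.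
Qed.

Lemma Ichi_inI t : J (cl t) -> inI (K := K) (n := n) t.
Proof.
move: {2}(cl t) (erefl (cl t)) => u; move=> tu Ju; rewrite tu in Ju; move: t tu.
elim: Ju => {u} [|u v _ IHu _ IHv|u e i j ij] t.
- move=> t0; apply: I_eq (I_0 K n) _; apply/clP.
  by rewrite t0 clC scale0r.
- rewrite -[u]cl_repr -[v]cl_repr -clD => /esym/clP; apply: I_eq.
  by apply: I_add; [apply: IHu | apply: IHv]; rewrite cl_repr.
have lij : lowerQ (e, i, j) by [].
move=> tE; apply: I_eq (I_gen (repr u) (dlt_m lij)) _; apply/clP.
rewrite tE clM cl_repr clB clC cl_sumQB xbarE; congr (_ * (_ - _%:A)).
  by under eq_bigr do rewrite clZ; rewrite sum_dlt.
by rewrite /chi (sum_dlt (e, i, j) (fun b => chi0 K b : K^o)) chi0E.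
Qed.

Lemma pieqP y y' : pieq (K := K) (n := n) y y' <-> J (cl y - cl y').
Proof. by rewrite -clB; split; [apply: inI_J | apply: Ichi_inI]. Qed.

Lemma cl_ad c y : cl (ad (K := K) (n := n) c y) = \sum_b c b *:
  (xq b.1.1 b.1.2 b.2 * cl y - cl (if Qpar b then tsigma (@Qpar n) y else y) * xq b.1.1
    b.1.2 b.2).
Proof.
rewrite cl_sumQB; apply: eq_bigr => -[[e i] j] _.
by rewrite clZ clB !clM.
Qed.

Lemma xbar_odd i j : xb true i j = xq true i j.
Proof. by rewrite xbarE /chiv scale0r subr0. Qed.

(** Up to parity signs, ad(a) y' and (a - chi(a)) y' differ by a left multiple of a - chi(a), which
    lies in I_chi. *)
Lemma inW_whittaker y : inW (K := K) (n := n) y ->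
  exists2 y', J (cl y - cl y') &
    forall e (i j : 'I_n), (j < i)%N -> J (xb e i j * cl y').
Proof.
case=> y' [/pieqP yy' ady']; exists y' => // e i j ij.
have /inI_J := ady' _ (@dlt_m (e, i, j) ij).
rewrite cl_ad sum_dlt /=; case: e => Je.
  rewrite xbar_odd -[_ * _](subrK (cl (tsigma (@Qpar n) y') * xq true i j)).
  by apply: Ichi_D => //; rewrite -xbar_odd; apply: Ichi_gen.
have -> : xb false i j * cl y' = xq false i j * cl y' - cl y' * xq false i j
    + cl y' * xb false i j.
  by rewrite xbarE mulrBl mulrBr mulr_algl mulr_algr addrA subrK.
by apply: Ichi_D => //; apply: Ichi_gen.
Qed.

(** Applied to the generators of I_chi, the hypothesis yields the Whittaker condition. Stated for
    all of I_chi it is stable under products, hence can be checked on Yangian generators. *)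
Lemma whittaker_inW y :
  (forall u, J u -> J (u * cl y)) -> inW (K := K) (n := n) y.
Proof.
move=> Jy; exists y; split; first by apply/pieqP; rewrite subrr; apply: Ichi_0.
move=> c mc; apply: Ichi_inI; rewrite cl_ad; apply: Ichi_sum => -[[e i] j] /=.
have [ij|/mc ->] := boolP (lowerQ (e, i, j)); last by rewrite scale0r; apply: Ichi_0.
apply: Ichi_Z; have Jxb e' : J (xb e' i j) by rewrite -[xb _ _ _]mul1r; apply: Ichi_gen.
case: e {ij} => /=; first by rewrite -xbar_odd; apply: Ichi_B; [apply: Jy|apply: Ichi_Ml].
have -> : xq false i j * cl y - cl y * xq false i j =
    xb false i j * cl y - cl y * xb false i j.
  by rewrite xbarE mulrBl mulrBr mulr_algl mulr_algr opprB addrA subrK.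
by apply: Ichi_B; [apply: Jy|apply: Ichi_Ml].
Qed.

Lemma filt_exhaust t u : (exists w, F w u) -> exists w, F w (cl t * u).
Proof.
elim: t u => [[[e i] j]|c|a IHa b IHb|a IHa b IHb] u [w Fu].
- exists (Num.max (w + ldeg i j) w).
  have -> : cl (Tg (e, i, j)) = xb e i j + (chiv K e i j)%:A by rewrite xbarE subrK.
  rewrite mulrDl mulr_algl; apply: filt_D; last first.
    by apply: filt_Z; apply: filt_mono Fu; rewrite le_max lexx orbT.
  by apply: filt_mono (filt_xbar xq_br _ _ _ Fu); rewrite le_max lexx.
- by exists w; rewrite clC mulr_algl; apply: filt_Z.
- have [w1 F1] := IHa u (ex_intro _ w Fu); have [w2 F2] := IHb u (ex_intro _ w Fu).
  exists (Num.max w1 w2); rewrite clD mulrDl; apply: filt_D.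
    by apply: filt_mono F1; rewrite le_max lexx.
  by apply: filt_mono F2; rewrite le_max lexx orbT.
by rewrite clM -mulrA; apply/IHa/IHb; exists w.
Qed.

Section Phi.
Variable hn : (0 < n)%N.

Lemma ord_lastE : ord_last hn = ord_max.
Proof. exact: val_inj. Qed.

Lemma ord_firstE : ord_first hn = ord0.
Proof. exact: val_inj. Qed.

Definition phi_gen (e : bool) (k : nat) : T :=
  tscale (sgnK K k) (serg K (n + k - 1)%N e (ord_last hn) (ord_first hn)).

(** The images of generators with second index -1 are forced by T_{-i,-j}^{(m)} = (-1)^m
    T_{i,j}^{(m)}. *)
Definition phi_img (g : YG) : T :=
  let: YT i j m := g in
  match i, j with
  | P1, P1 => phi_gen false m.+1
  | M1, P1 => phi_gen true m.+1
  | M1, M1 => tscale (sgnK K m.+1) (phi_gen false m.+1)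
  | P1, M1 => tscale (sgnK K m.+1) (phi_gen true m.+1)
  end.

Fixpoint phi (t : term K YG) : T :=
  match t with
  | Tg g => phi_img g
  | Tc c => Tc c
  | Tadd a b => Tadd (phi a) (phi b)
  | Tmul a b => Tmul (phi a) (phi b)
  end.

Lemma cl_serg m e i j :
  cl (serg K m.+1 e i j) = sgnc K e ^+ m.+1 *: Q m.+1 (false, j) (e, i).
Proof.
elim: m e i => [|m IHm] e i.
  rewrite expr1 gpowS (bigD1 (false, j)) //= eqxx mulr1 big1 ?addr0 => [|a /negPf].
    rewrite /gmx /= addbF /sgnc scale_sign; case: e => /=.
      by rewrite expr0 expr1 !mul1r mulN1r opprK.
    by rewrite expr0 expr1 mul1r mulN1r opprK.
  by rewrite eq_sym => ->; rewrite mulr0.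
set s := serg _ _ _ _ _.
have -> : s = Tadd (tsum [seq Tmul (qgen K false i k) (serg K m.+1 e k j) | k <- enum 'I_n])
  (tscale ((-1) ^+ m.+3) (tsum [seq Tmul (qgen K true i k) (serg K m.+1 (~~ e) k j) | k
    <- enum 'I_n])).
  by [].
clear s.
have sum_serg f e' :
    cl (tsum [seq Tmul (qgen K f i k) (serg K m.+1 e' k j) | k <- enum 'I_n]) =
    sgnc K e' ^+ m.+1 *: \sum_k xq f i k * Q m.+1 (false, j) (e', k).
  rewrite cl_tsum !big_map -!enumT !big_enum scaler_sumr; apply: eq_bigr => k _.
  by rewrite clM IHm -scalerAr.
have QSe : Q m.+2 (false, j) (e, i) = sgnc K e *:
    (\sum_k xq false i k * Q m.+1 (false, j) (e, k)
     + \sum_k xq true i k * Q m.+1 (false, j) (~~ e, k)).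
  rewrite gpowS sum_idx -big_split scaler_sumr -sumrN; apply: eq_bigr => k _.
  rewrite /gmx scale_sign [(_, _).1]/= [(_, _).2]/= .
  move: (Q m.+1) => q; clear; case: e.
    by rewrite /= expr0 expr1 !mul1r !mulN1r opprD !mulNr !opprK addrC.
  by rewrite /= expr0 expr1 !mul1r mulN1r.
rewrite clD clZ !{}sum_serg {}QSe.
move: (\sum_k _) (\sum_k _) => X Y.
(* The sign of this power cancels the alternating sign of Sergeev's recursion. *)
have -> : sgnc K (~~ e) = - sgnc K e by rewrite /sgnc signrN.
rewrite !scalerA scalerDr [(- sgnc K e) ^+ _]exprNn mulrA -exprD.
have -> : (-1 : K) ^+ (m.+3 + m.+1) = 1 by rewrite -signr_odd oddD /=; case: (odd m).
rewrite mul1r.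
have -> // : sgnc K e ^+ m.+2 * sgnc K e = sgnc K e ^+ m.+1.
by rewrite exprSr -mulrA -expr2 /sgnc sqrr_sign mulr1.
Qed.

Definition ixf (i : pm) : bool * 'I_n := (pp i, ord0).
Definition ixl (j : pm) : bool * 'I_n := (pp j, ord_max).

(** A representative of the image of T_{i,j}^{(k)} given by one formula for all signs and all k,
    including k = 0: it is [gtwist] with shift n'. *)
Definition Theta (i j : pm) (k : nat) : U :=
  sgnc K (pp j) ^+ n' *: Q (n' + k) (ixf i) (ixl j).

Lemma phi_Theta i j k : cl (phi (Tt K i j k.+1)) = Theta i j k.+1.
Proof.
have signX (b : bool) m : ((-1) ^+ b) ^+ m = (-1) ^+ (b && odd m) :> K.
  by case: b; rewrite ?expr1n // signr_odd.
have cl_img e : cl (phi_gen e k.+1) = (sgnK K k.+1 * sgnc K e ^+ (n' + k.+1)) *: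
    Q (n' + k.+1) (false, ord0) (e, ord_max).
  have nk : (n + k.+1 - 1 = (n' + k).+1)%N by lia.
  by rewrite clZ nk cl_serg ord_lastE ord_firstE scalerA addnS.
have negQ e : Q (n' + k.+1) (true, ord0) (~~ e, ord_max) =
    (-1 : K) ^+ (n' + k.+1) *: Q (n' + k.+1) (false, ord0) (e, ord_max).
  have := gpow_neg xq (n' + k.+1) (false, ord0) (e, ord_max).
  by move: (Q _) => q; rewrite /negi /= => ->; rewrite -[in RHS]signr_odd scale_sign
    signr_odd.
have cl_img2 e : cl (tscale (sgnK K k.+1) (phi_gen e k.+1)) = sgnc K e ^+ (n' + k.+1) *:
    Q (n' + k.+1) (false, ord0) (e, ord_max).
  by rewrite clZ cl_img scalerA mulrA -expr2 /sgnK sqrr_sign mul1r.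
rewrite /Theta /ixf /ixl; case: i; case: j.
- rewrite -[LHS]/(cl (phi_gen false k.+1)) cl_img [pp P1]/=.
  move: (Q _ _ _) => q; congr (_ *: _).
  rewrite /sgnK /sgnc !signX -[_ ^+ k.+1]signr_odd -!signr_addb oddD /=; congr (_ ^+ _).
  by case: (odd n'); case: (odd k).
- rewrite -[LHS]/(cl (tscale (sgnK K k.+1) (phi_gen true k.+1))) cl_img2 [pp P1]/= [pp
  M1]/=.
  by rewrite /sgnc !expr1n.
- rewrite -[LHS]/(cl (phi_gen true k.+1)) cl_img [pp P1]/= [pp M1]/= (negQ true) scalerA.
  move: (Q _ _ _) => q; congr (_ *: _).
  rewrite /sgnK /sgnc !signX -[_ ^+ k.+1]signr_odd -[_ ^+ (n' + _)]signr_odd.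
  rewrite -!signr_addb oddD /=; congr (_ ^+ _).
  by case: (odd n'); case: (odd k).
- rewrite -[LHS]/(cl (tscale (sgnK K k.+1) (phi_gen false k.+1))) cl_img2 [pp M1]/=
  (negQ false).
  rewrite scalerA; move: (Q _ _ _) => q; congr (_ *: _).
  by rewrite /sgnc expr1n mul1r.
Qed.

Lemma Theta0 i j : J (cl (phi (Tt K i j 0)) - Theta i j 0).
Proof.
rewrite -opprB; apply: Ichi_N; have := Ichi_Z (sgnc K (pp j) ^+ n') (gpow_norm xq_br
  (pp i) (pp j)).
rewrite /Theta addn0 scalerBr scalerA -[cl (phi _)]/(cl (Tc (dpm i j))) clC.
have -> // : sgnc K (pp j) ^+ n' * ((pp j == pp i)%:R * sgnc K (pp i) ^+ n') = dpm i j.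
case: i; case: j; rewrite /sgnc /dpm ?mul0r ?mulr0 //= mul1r -exprMn -expr2 sqrr_sign
  expr1n //.
Qed.

Lemma Ichi_phi_Mr t u : J u -> J (u * cl (phi t)).
Proof.
elim: t u => [[i j k]|c|a IHa b IHb|a IHa b IHb] u Ju.
- rewrite -[Tg _]/(Tt K i j k.+1) phi_Theta -scalerAr; apply: Ichi_Z.
  exact: Ichi_gpow_Mr xq_br _ _ _ _ Ju.
- by rewrite clC mulr_algr; apply: Ichi_Z.
- by rewrite clD mulrDr; apply: Ichi_D; [apply: IHa|apply: IHb].
- by rewrite clM mulrA; apply/IHb/IHa.
Qed.

Lemma Ichi_Theta_Mr i j k u : J u -> J (u * Theta i j k).
Proof. by move=> Ju; rewrite -scalerAr; apply/Ichi_Z/(Ichi_gpow_Mr xq_br). Qed.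

Lemma phi_TtJ i j k : J (cl (phi (Tt K i j k)) - Theta i j k).
Proof. by case: k => [|k]; [apply: Theta0 | rewrite phi_Theta subrr; apply: Ichi_0]. Qed.

(** * Congruence modulo I_chi and the defining relations *)

Definition eqJ (u v : U) := J (u - v).

Lemma eqJ_refl u : eqJ u u. Proof. by rewrite /eqJ subrr; apply: Ichi_0. Qed.

Lemma eqJ_sym u v : eqJ u v -> eqJ v u.
Proof. by move=> uv; rewrite /eqJ -opprB; apply: Ichi_N. Qed.

Lemma eqJ_trans u v w : eqJ u v -> eqJ v w -> eqJ u w.
Proof. by move=> uv vw; rewrite /eqJ -(subrKA v); apply: Ichi_D. Qed.

Lemma eqJ_D u v u' v' : eqJ u u' -> eqJ v v' -> eqJ (u + v) (u' + v').
Proof. by move=> ? ?; rewrite /eqJ opprD addrACA; apply: Ichi_D. Qed.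

Lemma eqJ_N u u' : eqJ u u' -> eqJ (- u) (- u').
Proof. by move=> ?; rewrite /eqJ -opprD; apply: Ichi_N. Qed.

Lemma eqJ_Z a u u' : eqJ u u' -> eqJ (a *: u) (a *: u').
Proof. by move=> ?; rewrite /eqJ -scalerBr; apply: Ichi_Z. Qed.

Lemma eqJ_M u u' v v' : (forall w, J w -> J (w * v')) ->
  eqJ u u' -> eqJ v v' -> eqJ (u * v) (u' * v').
Proof.
move=> Jv' uu vv; rewrite /eqJ -(subrKA (u * v')) -mulrBr -mulrBl.
by apply: Ichi_D; [apply: Ichi_Ml | apply: Jv'].
Qed.

Lemma Theta_neg i j m : Theta (negpm i) (negpm j) m = sgnK K m *: Theta i j m.
Proof.
have := gpow_neg xq (n' + m) (ixf i) (ixl j); rewrite /Theta.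
have -> : negi (ixf i) = ixf (negpm i) by case: i.
have -> : negi (ixl j) = ixl (negpm j) by case: j.
move=> ->; rewrite -signr_odd -scale_sign !scalerA; congr (_ *: _).
have -> : sgnc K (pp (negpm j)) = - sgnc K (pp j).
  by case: j; rewrite /sgnc /= ?expr0 ?expr1 ?opprK.
by rewrite exprNn signr_odd exprD /sgnK mulrACA -expr2 sqrr_sign mul1r mulrC.
Qed.

Lemma Theta_relation i j k l m r :
  let C m r := Theta i j m * Theta k l r
    - ((-1) ^+ ((pp i (+) pp j) && (pp k (+) pp l)) : K) *: (Theta k l r * Theta i j m) in
  sgnK K ((pp i && pp k) + (pp i && pp l) + (pp k && pp l)) *: (C m.+2 r - C m r.+2) =
  Theta k j m.+1 * Theta i l r + Theta k j m * Theta i l r.+1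
  - Theta k j r * Theta i l m.+1 - Theta k j r.+1 * Theta i l m
  + sgnK K (pp k + pp l) *:
   (- (Theta (negpm k) j m.+1 * Theta (negpm i) l r)
    + Theta (negpm k) j m * Theta (negpm i) l r.+1
    - - (Theta k (negpm j) r * Theta i (negpm l) m.+1)
    - Theta k (negpm j) r.+1 * Theta i (negpm l) m).
Proof.
have := gtwist_relation xq_br n' m r (ixf i) (ixl j) (ixf k) (ixl l).
have nf a : negi (ixf a) = ixf (negpm a) by case: a.
have nl a : negi (ixl a) = ixl (negpm a) by case: a.
have ThetaE p a b : gtwist xq n' p (ixf a) (ixl b) = Theta a b p.
  rewrite /gtwist -scale_sign /Theta /sgnc andbC; congr (_ *: _).
  by rewrite [(ixl b).1]/=; case: (pp b); rewrite /= ?expr1n // signr_odd.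
rewrite /scom /theta !{}nf !{}nl !{}ThetaE -!scale_sign /sgnK => rel.
rewrite -[_ ^+ (_ + _ + _)]signr_odd !oddD !oddb -[_ ^+ (pp k + _)]signr_odd oddD !oddb
  opprK.
exact: rel.
Qed.

Local Notation tau i j k := (cl (phi (Tt K i j k))).

Lemma eqJ_tauM i j k i' j' k' :
  eqJ (tau i j k * tau i' j' k') (Theta i j k * Theta i' j' k').
Proof.
by apply: eqJ_M; [move=> w; apply: Ichi_Theta_Mr | apply: phi_TtJ | apply: phi_TtJ].
Qed.

Lemma phi_add a b : phi (Tadd a b) = Tadd (phi a) (phi b). Proof. by []. Qed.

Lemma phi_mul a b : phi (Tmul a b) = Tmul (phi a) (phi b). Proof. by []. Qed.

Lemma phi_scale c a : phi (tscale c a) = tscale c (phi a). Proof. by []. Qed.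

Lemma phi_neg a : phi (tneg a) = tneg (phi a). Proof. by []. Qed.

Lemma phi_sub a b : phi (tsub a b) = tsub (phi a) (phi b). Proof. by []. Qed.

Lemma phi_RY t t' : RY t t' -> eqJ (cl (phi t)) (cl (phi t')).
Proof.
case=> {t t'} [i j m m0|i j k l m r m0 r0].
  by rewrite phi_scale clZ; case: m m0 => // m _; rewrite !phi_Theta Theta_neg; apply:
    eqJ_refl.
case: m m0 => // m _; case: r r0 => // r _ pij pkl.
rewrite /tscomm -!pred_Sn !(phi_sub, phi_neg, phi_scale, phi_add, phi_mul).
rewrite !(clB, clN, clZ, clD, clM).
have rel := Theta_relation i j k l m r.
(* The indices m - 1 and r - 1 may be 0, and T^{(0)} agrees with [Theta] only modulo I_chi; so both
   sides are first replaced by their [Theta] versions. *)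
eapply eqJ_trans.
  by repeat first [apply: eqJ_tauM | apply: eqJ_Z | apply: eqJ_N | apply: eqJ_D].
rewrite [X in eqJ X _]rel; apply: eqJ_sym.
by repeat first [apply: eqJ_tauM | apply: eqJ_Z | apply: eqJ_N | apply: eqJ_D].
Qed.

Lemma ueq_eqJ a b : ueq a b -> eqJ (cl a) (cl b).
Proof. by move/clP ->; apply: eqJ_refl. Qed.

Lemma phi_yeq t t' : yeq t t' -> eqJ (cl (phi t)) (cl (phi t')).
Proof.
elim=> {t t'}.
- exact: phi_RY.
- by move=> a; apply: eqJ_refl.
- by move=> a b _; apply: eqJ_sym.
- by move=> a b c _ ab _; apply: eqJ_trans.
- by move=> a a' b b' _ ea _ eb; rewrite !phi_add !clD; apply: eqJ_D.
- by move=> a a' b b' _ ea _ eb; rewrite !phi_mul !clM; apply: eqJ_M => // w; apply: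
  Ichi_phi_Mr.
- by move=> a b c; apply/ueq_eqJ/ce_addA.
- by move=> a b; apply/ueq_eqJ/ce_addC.
- by move=> a; apply/ueq_eqJ/ce_add0.
- by move=> a; apply/ueq_eqJ/ce_addN.
- by move=> a b c; apply/ueq_eqJ/ce_mulA.
- by move=> a; apply/ueq_eqJ/ce_mul1l.
- by move=> a; apply/ueq_eqJ/ce_mul1r.
- by move=> a b c; apply/ueq_eqJ/ce_mulDl.
- by move=> a b c; apply/ueq_eqJ/ce_mulDr.
- by move=> a b; apply/ueq_eqJ/ce_cadd.
- by move=> a b; apply/ueq_eqJ/ce_cmul.
- by move=> a b; apply/ueq_eqJ/ce_ccomm.
Qed.

(** * Parity of the images *)

Lemma homog_tsum p (I : Type) (f : I -> T) s :
  (forall i, homog (@Qpar n) p (f i)) -> homog (@Qpar n) p (tsum [seq f i | i <- s]).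
Proof. by move=> hf; elim: s => [|i s IHs] /=; [apply: hom_0 | apply: hom_add]. Qed.

Lemma homog_scale p c (t : T) : homog (@Qpar n) p t -> homog (@Qpar n) p (tscale c t).
Proof. exact: (hom_mul (hom_c _ _)). Qed.

Lemma homog_serg m e i j : homog (@Qpar n) e (serg K m.+1 e i j).
Proof.
elim: m e i => [|m IHm] e i; first exact: (hom_gen K (@Qpar n) (e, i, j)).
apply: hom_add.
  by apply: homog_tsum => k; apply: (hom_mul (hom_gen K (@Qpar n) (false, i, k)) (IHm e k)).
apply/homog_scale/homog_tsum => k.
by have := hom_mul (hom_gen K (@Qpar n) (true, i, k)) (IHm (~~ e) k); rewrite /= negbK.
Qed.

Lemma homog_phi g : homog (@Qpar n) (Ypar g) (phi (Tg g)).
Proof.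
case: g => i j m.
have himg e : homog (@Qpar n) e (phi_gen e m.+1).
  have -> : phi_gen e m.+1 = tscale (sgnK K m.+1) (serg K (n' + m).+1 e (ord_last hn)
    (ord_first hn)).
    by rewrite /phi_gen; congr (tscale _ (serg _ _ _ _ _)); lia.
  exact/homog_scale/homog_serg.
case: i; case: j => /=; [exact: himg | exact/homog_scale/himg | exact: himg |].
exact/homog_scale/himg.
Qed.

Lemma phi_superhom : W_superhom phi.
Proof.
have rf (y : T) : pieq y y by apply/pieqP; apply: eqJ_refl.
split=> [t|]; first by apply: whittaker_inW => u; apply: Ichi_phi_Mr.
split=> [t t' tt'|]; first by apply/pieqP; apply: phi_yeq.
split=> // g; exists (phi (Tg g)); split=> //; exact: homog_phi.
Qed.

Hypothesis char0 : [pchar K] =i pred0.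

Lemma phi_surjective : W_surjective phi.
Proof.
move=> y /inW_whittaker[y' yy' Wy'].
have [w Fw] : exists w, F w (cl y' * 1).
  by apply: filt_exhaust; exists 0; apply: filt_1.
rewrite mulr1 in Fw.
have [|||||c uc cn|_ [t <-] yt] := @whittaker_vectors K n' U xq xq_br char0
  (fun g => exists t, cl (phi t) = g) _ _ _ _ _ _ w (cl y') Fw Wy'.
- by move=> _ _ [a <-] [b <-]; exists (Tadd a b); apply: clD.
- by move=> c _ [a <-]; exists (tscale c a); rewrite phi_scale clZ.
- by move=> _ _ [a <-] [b <-]; exists (Tmul a b); apply: clM.
- by exists (Tc 1); rewrite /= clC scale1r.
- by move=> _ u [t <-]; apply: Ichi_phi_Mr.
- have [a _ Fa] := y_lead xq_br uc cn.
  exists (a *: Q (n + (n' - c.1.2)) (c.1.1, ord0) (false, ord_max)) => //.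
  pose i := if c.1.1 then M1 else P1.
  (* Row i, counted from 0, of the last column corresponds to T^{(n - i)}; the factor [sgnc] undoes
     the sign in [Theta]. *)
  exists (tscale (a * sgnc K false ^+ n') (Tg (YT i P1 (n' - c.1.2)))).
  rewrite phi_scale clZ -[Tg _]/(Tt K i P1 (n' - c.1.2).+1) phi_Theta /Theta scalerA -mulrA.
  rewrite -exprMn -expr2 /sgnc sqrr_sign expr1n mulr1 addSnnS; congr (_ *: Q _ _ _).
  by rewrite /ixf /i; case: c.1.1.
exists t; apply/pieqP; apply: eqJ_sym; exact: eqJ_trans yy' yt.
Qed.

End Phi.

End Hom.

Theorem theorem6p1 (K : fieldType) (hK : [pchar K] =i pred0)
    (n : nat) (hn : (0 < n)%N) :
  exists phi : term K YG -> term K (QB n),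
    [/\ W_superhom phi,
        W_surjective phi,
        (forall k : nat, (1 <= k)%N ->
           pieq (phi (Tt K P1 P1 k))
                (tscale (sgnK K k) (serg K (n:=n) (n + k - 1)%N false (ord_last hn) (ord_first hn)))) &
        (forall k : nat, (1 <= k)%N ->
           pieq (phi (Tt K M1 P1 k))
                (tscale (sgnK K k) (serg K (n:=n) (n + k - 1)%N true (ord_last hn) (ord_first hn))))].
Proof.
case: n hn => // n' hn; exists (@phi K n' hn); split.
- exact: phi_superhom.
- exact: phi_surjective.
- by case=> // k _; apply/pieqP; apply: eqJ_refl.
- by case=> // k _; apply/pieqP; apply: eqJ_refl.
Qed.
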